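(* Let $\omega$ be an algebraically $p$-clustering state with $p>2D$ (respectively, an exponentially $\alpha$-clustering state with $\alpha>0$). Then the form $\langle A,B\rangle_\omega:=\sum_{x\in\mathbb Z^D}\big(\omega(\iota_x(A)^*B)-\omega(A^* )\omega(B)\big)$ is an algebraically $q$-clustering form (respectively, an exponentially $\beta$-clustering form) on $\mathcal O$ with respect to $\omega$, for every $q$ with $D<q<p-D$ (respectively, every $\beta$ with $0<\beta<\alpha/2$).
   Context: Setting: Fix $D\ge1$, $\mathbb Z^D$ with $\mathrm{dist}(x,y)=\sum_i|x_i-y_i|$. $\mathcal O$ is a complex normed space with distinguished $\mathbf 1$ of norm 1, finite-dimensional subspaces $\mathcal O_X$ ($X$ finite) with $\mathcal O_\emptyset=\mathbb C\mathbf 1$, $X\subset Y\Rightarrow\mathcal O_X\subset\mathcal O_Y$, $\mathcal O_X\cap\mathcal O_Y=\mathcal O_{X\cap Y}$, $\mathcal O=\bigcup_X\mathcal O_X$; $\mathrm{supp}(A)$ smallest $X$ with $A\in\mathcal O_X$, $|A|=|\mathrm{supp}A|$, $\mathrm{dist}(A,B)$ distance of supports ($\mathrm{dist}(A,\mathbf 1)=\infty$), $\mathrm{diam}(A)$ diameter of $\mathrm{supp}A$. Completion $\mathcal A$ is a unital $C^*$-algebra, $\mathcal O_X$ are $C^*$-subalgebras, disjointly supported elements commute and their product has union support; translations $\iota_x$ are $*$-automorphisms, $\iota_x\iota_y=\iota_{x+y}$, $\mathrm{supp}(\iota_xA)=\mathrm{supp}(A)+x$. A state is a positive normalized linear functional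 on $\mathcal A$. A translation-invariant state $\omega$ is algebraically $p$-clustering ($p>D$) (resp. exponentially $\alpha$-clustering) if there exist $\nu:\mathbb N\to\mathbb R^+$ and $f:\mathbb Z\to\mathbb R^+$ with $f(d)\le d^{-p}$ (resp. $f(d)\le e^{-\alpha d}$) for all $d>0$ such that $|\omega(AB)-\omega(A)\omega(B)|\le\nu(\ell)\|A\|\|B\|f(\mathrm{dist}(A,B))$ for all $\ell$ and $A,B\in\mathcal O$ with $|A|,|B|<\ell$. A sesquilinear form $\langle\cdot,\cdot\rangle$ on $\mathcal O$ is an algebraically $q$-clustering (resp. exponentially $\beta$-clustering) form w.r.t. $\omega$ if it is translation invariant, positive semi-definite, and (I) there exist $\nu:\mathbb N\to\mathbb R^+$, $f:\mathbb Z\to\mathbb R^+$ with $f(d)\le d^{-q}$ (resp. $f(d)\le e^{-\beta d}$) for $d>0$ such that for all $\ell$ and $A,B,C\in\mathcal O$ with $|A|,|B|,|C|<\ell$: $|\langle A,BC\rangle-\langle A,B\rangle\omega(C)-\langle A,C\rangle\omega(B)|\le\nu(\ell)\|A\|\|B\|\|C\|f(\mathrm{dist}(B,C)-\mathrm{diam}(A))$; (II) for every $\ell>0$ there is $\kappa>0$ with $|\langle A,B\rangle|\le\kappa\|A\|\|B\|$ whenever $|A|,|B|<\ell$. *)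

(* Defs.v *)
From HB Require Import structures.
From mathcomp Require Import all_boot all_order all_algebra.
From mathcomp Require Import finmap.
From mathcomp Require Import boolp reals sequences exp.
From mathcomp Require Import complex.
Set Implicit Arguments. Unset Strict Implicit. Unset Printing Implicit Defensive.
Import Order.TTheory GRing.Theory Num.Theory.
Local Open Scope ring_scope.
Local Open Scope complex_scope.


Notation site D := 'rV[int]_D.

Definition l1 (D : nat) (x y : site D) : nat :=
  (\sum_(i < D) `|x ord0 i - y ord0 i|%N)%N.

(* diameter of a finite set (0 for the empty set) *)
Definition diamS (D : nat) (X : {fset site D}) : nat :=
  (\max_(x <- enum_fset X) \max_(y <- enum_fset X) l1 x y)%N.

(* distance between finite sets; None (= +infinity) if one of them is empty *)
Definition distS (D : nat) (X Y : {fset site D}) : option nat :=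
  if (X == fset0) || (Y == fset0) then None
  else Some (\big[minn/(\max_(x <- enum_fset X) \max_(y <- enum_fset Y) l1 x y)%N]_(x <- enum_fset X)
               \big[minn/(\max_(x <- enum_fset X) \max_(y <- enum_fset Y) l1 x y)%N]_(y <- enum_fset Y) l1 x y)%N.

Definition translS (D : nat) (X : {fset site D}) (x : site D) : {fset site D} :=
  [fset (y + x)%R | y in X]%fset.

Definition is_supp (D : nat) (O : Type) (loc : {fset site D} -> O -> Prop)
  (A : O) (X : {fset site D}) : Prop :=
  loc X A /\ forall Y, loc Y A -> fsubset X Y.

Definition supp_of (D : nat) (O : Type) (loc : {fset site D} -> O -> Prop) (A : O)
  : {fset site D} :=
  match pselect (exists X, is_supp loc A X) with
  | left h => projT1 (cid h)
  | right _ => fset0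
  end.

(* The quasi-local structure on a complex *-algebra O (the local algebra,
   whose completion is the C*-algebra 𝒜). *)
Record QLA (R : realType) (D : nat) (O : algType R[i]) := {
  star : O -> O;
  onorm : O -> R;
  loc : {fset site D} -> O -> Prop;
  iota : site D -> O -> O;
  star_invol : forall A, star (star A) = A;
  star_lin : forall (a : R[i]) A B, star (a *: A + B) = conjc a *: star A + star B;
  star_mul : forall A B, star (A * B) = star B * star A;
  onorm_ge0 : forall A, 0 <= onorm A;
  onorm_eq0 : forall A, onorm A = 0 -> A = 0;
  onorm_triangle : forall A B, onorm (A + B) <= onorm A + onorm B;
  onorm_scale : forall (a : R[i]) A, (onorm (a *: A))%:C = `|a| * (onorm A)%:C;
  onorm_submul : forall A B, onorm (A * B) <= onorm A * onorm B;
  onorm_star : forall A, onorm (star A) = onorm A;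
  onorm_Cstar : forall A, onorm (star A * A) = onorm A ^+ 2;
  onorm_one : onorm 1 = 1;
  loc_one : forall X, loc X 1;
  loc_lin : forall X (a : R[i]) A B, loc X A -> loc X B -> loc X (a *: A + B);
  loc_mul : forall X A B, loc X A -> loc X B -> loc X (A * B);
  loc_star : forall X A, loc X A -> loc X (star A);
  loc_findim : forall X, exists (n : nat) (b : 'I_n -> O),
      forall A, loc X A <-> exists c : 'I_n -> R[i], A = \sum_(k < n) c k *: b k;
  loc_empty : forall A, loc fset0 A <-> exists c : R[i], A = c%:A;
  loc_mono : forall X Y A, fsubset X Y -> loc X A -> loc Y A;
  loc_cap : forall X Y A, (loc X A /\ loc Y A) <-> loc (fsetI X Y) A;
  loc_cover : forall A, exists X, loc X A;
  disj_comm : forall A B, fdisjoint (supp_of loc A) (supp_of loc B) -> A * B = B * A;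
  disj_supp : forall A B, fdisjoint (supp_of loc A) (supp_of loc B) ->
      A != 0 -> B != 0 -> supp_of loc (A * B) = fsetU (supp_of loc A) (supp_of loc B);
  iota_lin : forall x (a : R[i]) A B, iota x (a *: A + B) = a *: iota x A + iota x B;
  iota_mul : forall x A B, iota x (A * B) = iota x A * iota x B;
  iota_one : forall x, iota x 1 = 1;
  iota_star : forall x A, iota x (star A) = star (iota x A);
  iota_norm : forall x A, onorm (iota x A) = onorm A;
  iota_bij : forall x, bijective (iota x);
  iota_comp : forall x y A, iota x (iota y A) = iota (x + y) A;
  iota_supp : forall x A, supp_of loc (iota x A) = translS (supp_of loc A) x
}.

Section QLADefs.
Variables (R : realType) (D : nat) (O : algType R[i]) (Q : QLA D O).

Definition supp (A : O) := supp_of (loc Q) A.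
Definition osize (A : O) : nat := #|` supp A|%fset.
Definition odist (A B : O) : option nat := distS (supp A) (supp B).
Definition odiam (A : O) : nat := diamS (supp A).

(* f evaluated at an extended distance; f(+infinity) = 0 *)
Definition fext (f : int -> R) (d : option int) : R :=
  match d with Some n => f n | None => 0 end.

(* a state on 𝒜, given by its (determining) restriction to the dense *-subalgebra O *)
Definition is_state (omega : O -> R[i]) : Prop :=
  (forall (a : R[i]) A B, omega (a *: A + B) = a * omega A + omega B) /\
  (forall A, 0 <= omega (star Q A * A)) /\ omega 1 = 1.

Definition transl_inv_state (omega : O -> R[i]) : Prop :=
  is_state omega /\ forall x A, omega (iota Q x A) = omega A.

Definition clustering_state (omega : O -> R[i]) (g : nat -> R) : Prop :=
  transl_inv_state omega /\
  exists (nu : nat -> R) (f : int -> R),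
    (forall l, 0 < nu l) /\ (forall d, 0 < f d) /\
    (forall d : nat, (0 < d)%N -> f d%:Z <= g d) /\
    forall (l : nat) (A B : O), (osize A < l)%N -> (osize B < l)%N ->
      `|omega (A * B) - omega A * omega B|
        <= (nu l * onorm Q A * onorm Q B * fext f (omap (fun n : nat => n%:Z) (odist A B)))%:C.

Definition alg_clustering_state (omega : O -> R[i]) (p : R) : Prop :=
  D%:R < p /\ clustering_state omega (fun d => powR d%:R (- p)).

Definition exp_clustering_state (omega : O -> R[i]) (alpha : R) : Prop :=
  clustering_state omega (fun d => expR (- (alpha * d%:R))).

Definition clustering_form (omega : O -> R[i]) (form : O -> O -> R[i]) (g : nat -> R)
  : Prop :=
  (forall x A B, form (iota Q x A) (iota Q x B) = form A B) /\
  (forall (a : R[i]) A B C, form (a *: A + B) C = conjc a * form A C + form B C) /\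
  (forall (a : R[i]) A B C, form A (a *: B + C) = a * form A B + form A C) /\
  (forall A, 0 <= form A A) /\
  (exists (nu : nat -> R) (f : int -> R),
    (forall l, 0 < nu l) /\ (forall d, 0 < f d) /\
    (forall d : nat, (0 < d)%N -> f d%:Z <= g d) /\
    forall (l : nat) (A B C : O),
      (osize A < l)%N -> (osize B < l)%N -> (osize C < l)%N ->
      `|form A (B * C) - form A B * omega C - form A C * omega B|
        <= (nu l * onorm Q A * onorm Q B * onorm Q C *
            fext f (omap (fun n : nat => n%:Z - (odiam A)%:Z) (odist B C)))%:C) /\
  (forall l : nat, (0 < l)%N -> exists kappa : R, 0 < kappa /\
     forall A B : O, (osize A < l)%N -> (osize B < l)%N ->
       `|form A B| <= (kappa * onorm Q A * onorm Q B)%:C).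

Definition alg_clustering_form omega form (q : R) :=
  clustering_form omega form (fun d => powR d%:R (- q)).

Definition exp_clustering_form omega form (beta : R) :=
  clustering_form omega form (fun d => expR (- (beta * d%:R))).

Definition has_sum (u : site D -> R[i]) (z : R[i]) : Prop :=
  forall e : R, 0 < e -> exists S0 : {fset site D}, forall S : {fset site D},
    fsubset S0 S -> `|\sum_(x <- enum_fset S) u x - z| < e%:C.

Definition is_GNS_sum_form (omega : O -> R[i]) (form : O -> O -> R[i]) : Prop :=
  forall A B : O, has_sum (fun x => omega (star Q (iota Q x A) * B)
                                   - omega (star Q A) * omega B) (form A B).

End QLADefs.

(* Main.v *)
Require Import Defs.
From HB Require Import structures.
From mathcomp Require Import all_boot all_order all_algebra.
From mathcomp Require Import finmap.
From mathcomp Require Import boolp classical_sets reals sequences exp.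
From mathcomp Require Import complex.
From mathcomp Require Import ring lra zify.
Import Order.TTheory GRing.Theory Num.Theory ComplexField.Normc.
Local Open Scope ring_scope.
Set Implicit Arguments. Unset Strict Implicit. Unset Printing Implicit Defensive.

(** The cumulant
      T(x) = w(A_x BC) - w(A_x) w(BC) - w(A_x B) w(C) - w(A_x C) w(B) + 2 w(A_x) w(B) w(C),
    with A_x the adjoint of the translate of A, is the x-term of
    <A,BC> - <A,B> w(C) - <A,C> w(B). Splitting A_x off from BC bounds T(x) by
    h(r), where r = dist(A_x, BC) and h is the decay of the state. On the other hand, if
    n = dist(B,C) - diam(A) > 0, then A_x is at distance at least n/2 from B or from C;
    splitting off that observable bounds T(x) by h(n/2). Writing h = t s, both bounds
    give T(x) <= t(n/2) s(r) up to constants, and the sum over x converges as soon as s is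
    summable over the lattice: t = d^(-q), s = d^(-(p-q)) in the algebraic case,
    t = e^(-2 beta d), s = e^(-(alpha-2 beta) d) in the exponential one.

    Positivity of the form comes from averaging over large boxes, since the variance of
    the sum of the translates of A over a box is nonnegative. *)

(** * Sums over the lattice *)
Section LatticeSums.
Variable R : realType.

(** The absolute values and signs of its coordinates determine a site, so the sum is dominated by
    one over all choices of these data. That sum factors over the coordinates, and the two signs
    give the factor 2. *)
Lemma sum_prod_coord_le (D : nat) (u : nat -> R) (U : R) :
  (forall k, 0 <= u k) -> (forall N, \sum_(k < N) u k <= U) ->
  forall W : {fset site D},
    \sum_(x <- enum_fset W) \prod_(i < D) u `|x ord0 i|%N <= (2 * U) ^+ D.
Proof.
move=> u0 uU W.
pose N := (\max_(x <- enum_fset W) \max_(i < D) `|x ord0 i|)%N.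
have leN (x : site D) (i : 'I_D) : x \in W -> (`|x ord0 i| <= N)%N.
  move=> xW; apply: (@leq_trans (\max_(i < D) `|x ord0 i|)%N).
    by rewrite (leq_bigmax i).
  by apply: (leq_bigmax_seq x (F := fun x : site D => (\max_(i < D) `|x ord0 i|)%N)) => //.
pose phi (x : site D) : {ffun 'I_D -> 'I_N.+1 * bool} :=
  [ffun i => (inord `|x ord0 i|%N, x ord0 i < 0)].
pose G (g : {ffun 'I_D -> 'I_N.+1 * bool}) := \prod_(i < D) u (g i).1.
have G0 g : 0 <= G g by apply: prodr_ge0 => i _; exact: u0.
have phi_inj : {in W &, injective phi}.
  move=> x y xW yW /ffunP e; apply/rowP => i.
  have := e i; rewrite !ffunE => -[/(congr1 val)]; rewrite /= !inordK ?ltnS ?leN//.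
  move: (x ord0 i) (y ord0 i) => [a|a] [b|b] /=; lia.
have -> : \sum_(x <- enum_fset W) \prod_(i < D) u `|x ord0 i|%N
    = \sum_(g <- map phi (enum_fset W)) G g.
  rewrite big_map; apply: eq_big_seq => x xW; apply: eq_bigr => i _.
  by rewrite ffunE /= inordK ?ltnS ?leN.
rewrite big_uniq ?map_inj_in_uniq ?fset_uniq// /=.
apply: (@le_trans _ _ (\sum_g G g)).
  rewrite [leRHS](bigID [in map phi (enum_fset W)]) /= lerDl.
  by apply: sumr_ge0.
rewrite /G -(bigA_distr_bigA (fun _ (p : 'I_N.+1 * bool) => u p.1)) /=.
rewrite prodr_const card_ord lerXn2r ?nnegrE//.
- by apply: sumr_ge0.
- by rewrite mulr_ge0// (le_trans _ (uU 0)) // big_ord0.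
rewrite -(pair_big xpredT xpredT (fun (k : 'I_N.+1) (_ : bool) => u k)) /=.
rewrite (eq_bigr (fun k : 'I_N.+1 => 2 * u k)) => [|k _].
  by rewrite -mulr_sumr ler_pM2l ?uU.
by rewrite sumr_const card_bool mulr_natl.
Qed.

Lemma sum_expR_le (c : R) : 0 < c ->
  forall N, \sum_(k < N) expR (- (c * k%:R)) <= (1 - expR (- c))^-1.
Proof.
move=> c0 N; have q1 : expR (- c) < 1 by rewrite expR_lt1; lra.
have q0 := expR_gt0 (- c).
rewrite (eq_bigr (fun k : 'I_N => expR (- c) ^+ k)) => [|k _].
  rewrite -(@ler_pM2l _ (1 - expR (- c))) ?subr_gt0//.
  rewrite -[_ * \sum_(_ < _) _]opprK -mulNr opprB -subrX1 divff.
    by rewrite opprB gerBl exprn_ge0// ltW.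
  by rewrite gt_eqF// subr_gt0.
by rewrite -expRM_natr mulNr.
Qed.

(* [(1 + 1/(k+1))^b >= 1 + b ln(1 + 1/(k+1)) >= 1 + b/(k+2)]. *)
Lemma powR_telescope (b : R) (k : nat) : 0 < b ->
  b * powR k.+2%:R (- (1 + b)) <= powR k.+1%:R (- b) - powR k.+2%:R (- b).
Proof.
move=> b0.
have k1 : 0 < k.+1%:R :> R by rewrite ltr0n.
have k2 : 0 < k.+2%:R :> R by rewrite ltr0n.
have -> : powR k.+2%:R (- (1 + b)) = powR k.+2%:R (- b) / k.+2%:R.
  rewrite opprD addrC powRD; last by rewrite (lt0r_neq0 k2) implybT.
  by rewrite powR_inv1// ltW.
have -> : powR k.+1%:R (- b) = powR k.+2%:R (- b) * powR (k.+2%:R / k.+1%:R) b.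
  rewrite powRM ?ltW ?invr_gt0// mulrA -powRD; last by rewrite (lt0r_neq0 k2) implybT.
  rewrite addNr powRr0 mul1r -powR_inv1 ?ltW//.
  by rewrite -powRrM mulN1r.
rewrite mulrCA -[X in _ <= _ - X]mulr1 -mulrBr ler_pM2l ?powR_gt0//.
rewrite /powR gt_eqF ?divr_gt0//.
apply: le_trans (_ : b * ln (k.+2%:R / k.+1%:R) <= _); last first.
  by have := expR_ge1Dx (b * ln (k.+2%:R / k.+1%:R : R)); lra.
rewrite ler_pM2l//.
(* The bound [ln (1 + x) <= x] at [x = -1/(k+2)], where [1 + x] is the inverse of [(k+2)/(k+1)],
   gives [ln ((k+2)/(k+1)) >= 1/(k+2)]. *)
have := @le_ln1Dx R (- k.+2%:R^-1).
have -> : 1 - k.+2%:R^-1 = (k.+2%:R / k.+1%:R)^-1 :> R.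
  rewrite invf_div; apply: (@mulIf _ k.+2%:R); first by rewrite gt_eqF.
  by rewrite divfK ?gt_eqF// mulrBl mulVf ?gt_eqF// mul1r -[k.+2]addn1 natrD addrK.
rewrite lnV ?posrE ?divr_gt0// => /(_ _); rewrite ltrN2 invf_lt1// ltr1n => /(_ isT).
by rewrite lerN2.
Qed.

(** The first term equals 1; the others, multiplied by [b], are dominated by a telescoping sum of
    total at most 1. *)
Lemma sum_powR_le (b : R) : 0 < b ->
  forall N, \sum_(k < N) powR k.+1%:R (- (1 + b)) <= 1 + b^-1.
Proof.
move=> b0 [|N]; first by rewrite big_ord0 addr_ge0// invr_ge0 ltW.
rewrite big_ord_recl /= powR1 lerD2l -(ler_pM2l b0) divff ?gt_eqF// mulr_sumr.
apply: le_trans (_ : \sum_(k < N) (powR k.+1%:R (- b) - powR k.+2%:R (- b)) <= _).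
  by apply: ler_sum => k _; exact: powR_telescope.
rewrite -(big_mkord xpredT (fun k => powR k.+1%:R (- b) - powR k.+2%:R (- b))).
rewrite -(eq_bigr _ (fun k _ => opprB _ _)) sumrN telescope_sumr// opprB powR1.
by rewrite gerBl powR_ge0.
Qed.

Lemma l1_coord_le (D : nat) (x : site D) (i : 'I_D) : (`|x ord0 i| <= l1 x 0)%N.
Proof. by rewrite /l1 (bigD1 i) //= mxE subr0 leq_addr. Qed.

Definition lattice_summable (D : nat) (s : nat -> R) :=
  exists S : R, forall W : {fset site D}, \sum_(x <- enum_fset W) s (l1 x 0) <= S.

(** The exponential of the l1 norm factors over the coordinates into geometric series. *)
Lemma expR_lattice_summable (D : nat) (c : R) : 0 < c ->
  lattice_summable D (fun d => expR (- (c * d%:R))).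
Proof.
move=> c0; exists ((2 * (1 - expR (- c))^-1) ^+ D) => W.
have := @sum_prod_coord_le D _ _ (fun k => expR_ge0 (- (c * k%:R))) (sum_expR_le c0) W.
apply: le_trans; apply: ler_sum => x _.
rewrite -expR_sum ler_expR sumrN lerN2 -mulr_sumr -natr_sum ler_pM2l// ler_nat.
by rewrite /l1 leq_sum// => i _; rewrite mxE subr0.
Qed.

(** Since [1 + l1 x 0] is at least each [1 + |x_i|], its power [-(1+b)D] is at most the product of
    the [(1 + |x_i|)^(-(1+b))], and each factor is summable over one coordinate. *)
Lemma powR_lattice_summable (D : nat) (a : R) : D%:R < a ->
  lattice_summable D (fun d => powR d.+1%:R (- a)).
Proof.
move=> Da.
(* The excess of [a] over [D] is shared equally among the coordinates; in dimension 0 any positive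
   [b] will do. *)
have [b b0 ba] : exists2 b : R, 0 < b & (1 + b) * D%:R <= a.
  case: D Da => [|D] Da; first by exists 1; rewrite ?mulr0 ?ltW.
  exists (a / D.+1%:R - 1); first by rewrite subr_gt0 ltr_pdivlMr ?mul1r.
  by rewrite addrC subrK divfK ?pnatr_eq0.
exists ((2 * (1 + b^-1)) ^+ D) => W.
have := @sum_prod_coord_le D _ _ (fun k => powR_ge0 k.+1%:R (- (1 + b)))
  (sum_powR_le b0) W.
apply: le_trans; apply: ler_sum => x _.
apply: le_trans (_ : powR (l1 x 0).+1%:R (- ((1 + b) * D%:R)) <= _).
  by apply: ler_powR; rewrite ?ler1n ?lerN2.
rewrite -mulNr powRrM powR_mulrn ?powR_ge0// -[X in _ ^+ X](card_ord D) -prodr_const.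
apply: ler_prod => i _; rewrite powR_ge0 /= !powRN lef_pV2 ?posrE ?powR_gt0//.
by rewrite ge0_ler_powR ?nnegrE ?ler_nat ?ltnS ?l1_coord_le//; lra.
Qed.

End LatticeSums.

(** * Unconditional sums *)
Section Sums.
Variable R : realType.
Implicit Types z w : R[i].

Lemma normc_normE z : `|z| = (normc z)%:C%C.
Proof. by []. Qed.

Lemma normc_ge0 z : 0 <= normc z.
Proof. by rewrite -lecR -normc_normE normr_ge0. Qed.

Lemma normc_real (r : R) : normc r%:C%C = `|r|.
Proof. by rewrite /normc /= expr0n addr0 sqrtr_sqr. Qed.

Lemma le_normc_sum (I : Type) (r : seq I) (P : pred I) (F : I -> R[i]) :
  normc (\sum_(i <- r | P i) F i) <= \sum_(i <- r | P i) normc (F i).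
Proof.
elim/big_rec2: _ => [|i y x _ le]; first by rewrite normc0.
by rewrite (le_trans (le_normcD _ _))// lerD2l.
Qed.

Lemma big_fset_split (V : nmodType) (T : choiceType) (f : T -> V) (A B : {fset T}) :
  fsubset A B ->
  \sum_(x <- enum_fset B) f x
    = \sum_(x <- enum_fset A) f x + \sum_(x <- enum_fset (B `\` A)%fset) f x.
Proof.
move=> AB; rewrite (big_fsetID _ [in A]) /=; congr (_ + _); apply: eq_fbigl => x.
  by rewrite !inE /= andbC; case xA : (x \in A) => //=; rewrite (fsubsetP AB).
by rewrite !inE /= andbC.
Qed.

Lemma sum_fset_le (T : choiceType) (f : T -> R) (A B : {fset T}) :
  (forall x, 0 <= f x) -> fsubset A B ->
  \sum_(x <- enum_fset A) f x <= \sum_(x <- enum_fset B) f x.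
Proof. by move=> f0 AB; rewrite (big_fset_split _ AB) lerDl sumr_ge0. Qed.

Variable D : nat.
Implicit Types u v : site D -> R[i].

Lemma has_sumD u v z w :
  has_sum u z -> has_sum v w -> has_sum (fun x => u x + v x) (z + w).
Proof.
move=> hu hv e e0; have e2 : 0 < e / 2 by lra.
have [S1 h1] := hu _ e2; have [S2 h2] := hv _ e2.
exists (fsetU S1 S2) => S; rewrite fsubUset => /andP[/h1 l1 /h2 l2].
rewrite big_split /= opprD addrACA (le_lt_trans (ler_normD _ _))//.
have -> : (e = e / 2 + e / 2) by lra.
by rewrite rmorphD ltrD.
Qed.

Lemma has_sumZ (a : R[i]) u z : has_sum u z -> has_sum (fun x => a * u x) (a * z).
Proof.
move=> hu e e0; have c0 : 0 < normc a + 1 by have := normc_ge0 a; lra.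
have [S1 h1] := hu _ (divr_gt0 e0 c0); exists S1 => S /h1.
rewrite -mulr_sumr -mulrBr !normc_normE !ltcR normcM ltr_pdivlMr//.
by have := normc_ge0 (\sum_(x <- enum_fset S) u x - z); nra.
Qed.

Lemma has_sum_eq u v z : u =1 v -> has_sum u z -> has_sum v z.
Proof. by move=> /funext ->. Qed.

Lemma has_sum0 : has_sum (fun _ : site D => 0 : R[i]) 0.
Proof. by move=> e e0; exists fset0 => S _; rewrite big1// subr0 normr0 ltcR. Qed.

Lemma has_sum_normc_le u z (B : R) : has_sum u z ->
  (forall W : {fset site D}, normc (\sum_(x <- enum_fset W) u x) <= B) ->
  normc z <= B.
Proof.
move=> hu le; apply/ler_addgt0Pr => e e0; have [S h] := hu _ e0.
have := h _ (fsubset_refl S); rewrite normc_normE ltcR => hS.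
have -> : z = \sum_(x <- enum_fset S) u x - (\sum_(x <- enum_fset S) u x - z).
  by rewrite opprB addrC subrK.
rewrite (le_trans (le_normcD _ _))// normcN lerD ?le// ltW//.
Qed.

Lemma has_sum_unique u z w : has_sum u z -> has_sum u w -> z = w.
Proof.
move=> hz hw; apply/eqP; rewrite -subr_eq0; apply/eqP/eq0_normc/eqP.
rewrite eq_le normc_ge0 andbT; apply: (@has_sum_normc_le (fun=> 0)).
  rewrite -mulN1r; apply: has_sum_eq (has_sumD hz (has_sumZ (-1) hw)) => x.
  by rewrite mulN1r subrr.
by move=> W; rewrite big1 ?normc0.
Qed.

(** The sum is the supremum of the finite partial sums, which increase with the finite set. *)
Lemma nonneg_has_sum (f : site D -> R) (B : R) : (forall x, 0 <= f x) ->
  (forall W : {fset site D}, \sum_(x <- enum_fset W) f x <= B) ->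
  exists z, has_sum (fun x => (f x)%:C%C) z.
Proof.
move=> f0 fB; pose E (r : R) := exists W : {fset site D}, r = \sum_(x <- enum_fset W) f x.
have supE : has_sup E.
  by split; [exists 0, fset0; rewrite big_seq_fset0 | exists B => _ [W ->]].
exists (sup E)%:C%C => e e0; have [_ [S0 ->] lt] := sup_adherent e0 supE.
exists S0 => S SS; rewrite -rmorph_sum -rmorphB normc_normE ltcR normc_real.
have le1 := sum_fset_le f0 SS.
have le2 : \sum_(x <- enum_fset S) f x <= sup E.
  by apply: sup_upper_bound supE _ _; exists S.
by rewrite ler0_norm; lra.
Qed.

(** Here [f] is the difference of the nonnegative summable functions [|f| + f] and [|f|]. *)
Lemma real_has_sum (f : site D -> R) (B : R) :
  (forall W : {fset site D}, \sum_(x <- enum_fset W) `|f x| <= B) ->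
  exists z, has_sum (fun x => (f x)%:C%C) z.
Proof.
move=> fB; have [z1 h1] := nonneg_has_sum (fun x => normr_ge0 (f x)) fB.
have [x|W|z2 h2] := @nonneg_has_sum (fun x => `|f x| + f x) (B + B).
- by have := ler_norm (- f x); rewrite normrN; lra.
- rewrite big_split /= lerD// (le_trans _ (fB W))// ler_sum// => x _.
  exact: ler_norm.
exists (z2 + -1 * z1); apply: has_sum_eq (has_sumD h2 (has_sumZ (-1) h1)) => x.
by rewrite rmorphD mulN1r addrAC subrr add0r.
Qed.

Lemma abs_has_sum u (B : R) :
  (forall W : {fset site D}, \sum_(x <- enum_fset W) normc (u x) <= B) ->
  exists z, has_sum u z.
Proof.
move=> uB.
have [W|z1 h1] := @real_has_sum (fun x => complex.Re (u x)) B.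
  rewrite (le_trans _ (uB W))// ler_sum// => x _.
  by rewrite -lecR -normc_normE normc_ge_Re.
have [W|z2 h2] := @real_has_sum (fun x => complex.Im (u x)) B.
  rewrite (le_trans _ (uB W))// ler_sum// => x _; case: (u x) => a b /=.
  by rewrite -sqrtr_sqr ler_wsqrtr// lerDr sqr_ge0.
exists (z1 + 'i%C * z2); apply: has_sum_eq (has_sumD h1 (has_sumZ 'i%C h2)) => x.
by case: (u x) => a b /=; simpc.
Qed.

End Sums.

(** * States are contractive *)
Section States.
Variables (R : realType) (D : nat) (O : algType R[i]) (Q : QLA D O).
Implicit Types A B C H : O.
Local Notation st := (star Q).
Local Notation nm := (onorm Q).

Lemma star_one : st 1 = 1.
Proof. by have := star_mul Q (st 1) 1; rewrite mulr1 star_invol mulr1 => <-. Qed.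

Lemma star_zero : st 0 = 0.
Proof.
have := star_lin Q (-1) 0 0; rewrite scaler0 addr0 rmorphN1 scaleN1r => {1}->.
by rewrite addNr.
Qed.

Lemma starD A B : st (A + B) = st A + st B.
Proof. by have := star_lin Q 1 A B; rewrite !scale1r rmorph1 scale1r. Qed.

Lemma starZ (a : R[i]) A : st (a *: A) = conjc a *: st A.
Proof. by have := star_lin Q a A 0; rewrite !addr0 star_zero addr0. Qed.

Lemma star_sum (I : Type) (r : seq I) (F : I -> O) :
  st (\sum_(i <- r) F i) = \sum_(i <- r) st (F i).
Proof. by elim/big_rec2: _ => [|i y x _ <-]; rewrite ?star_zero ?starD. Qed.

Lemma onormZ (a : R[i]) A : nm (a *: A) = normc a * nm A.
Proof.
by apply/eqP; rewrite -(inj_eq (@complexI R)) onorm_scale normc_normE rmorphM.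
Qed.

Variable omega : O -> R[i].
Hypothesis omega_state : is_state Q omega.

Lemma state_lin (a : R[i]) A B : omega (a *: A + B) = a * omega A + omega B.
Proof. by case: omega_state. Qed.

Lemma state_one : omega 1 = 1.
Proof. by case: omega_state => _ []. Qed.

Lemma state_pos A : 0 <= omega (st A * A).
Proof. by case: omega_state => _ []. Qed.

Lemma state_zero : omega 0 = 0.
Proof.
by have := state_lin (-1) 0 0; rewrite scaler0 addr0 mulN1r addNr.
Qed.

Lemma stateD A B : omega (A + B) = omega A + omega B.
Proof. by have := state_lin 1 A B; rewrite scale1r mul1r. Qed.

Lemma stateZ (a : R[i]) A : omega (a *: A) = a * omega A.
Proof. by have := state_lin a A 0; rewrite !addr0 state_zero addr0. Qed.

Lemma state_sum (I : Type) (r : seq I) (F : I -> O) :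
  omega (\sum_(i <- r) F i) = \sum_(i <- r) omega (F i).
Proof. by elim/big_rec2: _ => [|i y x _ <-]; rewrite ?state_zero ?stateD. Qed.

(** Polarization: the state is real on [(A + c)^* (A + c)], so the cross terms have zero imaginary
    part, and [c = 1] and [c = i] settle the real and imaginary parts. *)
Lemma state_star A : omega (st A) = conjc (omega A).
Proof.
have im0 (z : R[i]) : 0 <= z -> complex.Im z = 0.
  by rewrite lecE /= => /andP[/eqP].
have key c : complex.Im (c * omega (st A) + conjc c * omega A) = 0.
  have := state_pos (A + c *: 1).
  rewrite starD starZ star_one mulrDl !mulrDr !stateD -!scalerAl -!scalerAr !stateZ.
  rewrite !mulr1 !mul1r state_one => /im0; have /im0 := state_pos A.
  case: (omega (st A * A)) (omega (st A)) (omega A) c => [? ?] [? ?] [? ?] [? ?] /=.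
  by move=> -> ; lra.
have := key 1; have := key 'i%C.
by case: (omega (st A)) (omega A) => [a b] [c d] /=; simpc => h1 h2; congr Complex; lra.
Qed.

(** This is positivity of the state at the centred observable [A - omega(A) 1]. *)
Lemma state_Cauchy_Schwarz A : omega (st A) * omega A <= omega (st A * A).
Proof.
rewrite -subr_ge0; have := state_pos (A - omega A *: 1).
rewrite starD -scaleNr starZ star_one mulrDl !mulrDr !stateD -!scalerAl -!scalerAr !stateZ.
rewrite !mulr1 !mul1r state_one mulr1 state_star rmorphN /=.
by congr (_ <= _); ring.
Qed.

Lemma state_Cauchy_Schwarz_normc A : normc (omega A) ^+ 2 <= normc (omega (st A * A)).
Proof.
have := state_Cauchy_Schwarz A; rewrite state_star mulrC -sqr_normc.
move=> le; rewrite -lecR rmorphXn /= -normc_normE (le_trans le)//.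
by rewrite -normc_normE ger0_norm ?state_pos.
Qed.

(* The local algebra is not complete, so that [nm H - H] need not have a square root at
   hand; contractivity is derived instead from the growth of the moments of [H]. A root [z]
   with [|z| > nm H] can be dropped from the annihilating product because [H - z] is then
   injective; any other root contributes at most geometric growth. *)
Lemma state_power_growth H (r : R) : nm H < r -> forall (s : seq R[i]) (v : O),
  (\prod_(z <- s) (H - z%:A)) * v = 0 ->
  exists2 K : R, 0 <= K & forall n, normc (omega (H ^+ n * v)) <= K * r ^+ n.
Proof.
move=> Hr; have r0 : 0 < r by apply: le_lt_trans Hr; exact: onorm_ge0.
elim=> [|z s IH] v.
  rewrite big_nil mul1r => ->; exists 0 => // n.
  by rewrite mulr0 state_zero normc0 mul0r.
rewrite big_cons; set P := \prod_(_ <- _) _ => Pv0.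
have [zH|Hz] := ltP (nm H) (normc z).
  apply: IH; apply: (onorm_eq0 (q := Q)); apply/eqP.
  rewrite eq_le onorm_ge0 andbT leNgt; apply/negP => w0.
  have e : H * (P * v) = z *: (P * v).
    by apply/eqP; rewrite -subr_eq0 -mulr_algl -mulrBl mulrA Pv0.
  have := onorm_submul Q H (P * v); rewrite e onormZ ler_pM2r//.
  by rewrite leNgt zH.
have scal (z' : R[i]) B : GRing.comm B z'%:A.
  by rewrite /GRing.comm mulr_algl mulr_algr.
have comm : GRing.comm (H - z%:A) P.
  apply: commr_prod => y _; apply: commrB (scal _ _).
  exact/commr_sym/commrB.
have [|K K0 hK] := IH ((H - z%:A) * v); first by rewrite mulrA -comm.
(* The second summand makes [K + nm H * K' <= r * K'], which closes the recursion in [n]; the first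
   covers [n = 0]. *)
pose K' := normc (omega v) + K / (r - nm H).
have rH : 0 < r - nm H by rewrite subr_gt0.
exists K' => [|n].
  by rewrite addr_ge0 ?normc_ge0// divr_ge0// ltW.
have leK : K <= K' * (r - nm H).
  by rewrite mulrDl divfK ?gt_eqF// lerDr mulr_ge0 ?normc_ge0 ?ltW.
elim: n => [|n IHn].
  by rewrite !expr0 mul1r mulr1 lerDl divr_ge0// ltW.
have -> : H ^+ n.+1 * v = H ^+ n * ((H - z%:A) * v) + z *: (H ^+ n * v).
  by rewrite mulrBl mulrBr mulr_algl -scalerAr subrK mulrA exprSr.
rewrite stateD stateZ (le_trans (le_normcD _ _))// normcM.
have rn : 0 < r ^+ n by rewrite exprn_gt0.
have h1 : normc z * normc (omega (H ^+ n * v)) <= nm H * (K' * r ^+ n).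
  by rewrite ler_pM ?normc_ge0.
rewrite (le_trans (lerD (hK n) h1))// exprS.
by have := ler_wpM2r (ltW rn) leK; lra.
Qed.

(** All powers of [H] lie in one local algebra of finite dimension [n], so the first [n + 1] of them
    are linearly dependent. The resulting polynomial splits into linear factors over the complex
    numbers. *)
Lemma annihilating_roots H : exists s : seq R[i], \prod_(z <- s) (H - z%:A) = 0.
Proof.
have [X XH] := loc_cover Q H; have [n [b hb]] := loc_findim Q X.
have pw j : loc Q X (H ^+ j).
  by elim: j => [|j IH]; rewrite ?expr0 ?exprS; [exact: loc_one | exact: loc_mul].
have /choice[c hc] : forall j : nat, exists c : 'I_n -> R[i],
  H ^+ j = \sum_(k < n) c k *: b k by move=> j; apply/hb.
(* The rows are the coordinates of the powers of [H]; having more rows than columns, [M] has a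
   nonzero left kernel vector, whose entries are the coefficients of the polynomial. *)
pose M : 'M[R[i]]_(n.+1, n) := \matrix_(j, k) c j k.
have kerM : kermx M != 0.
  by rewrite -mxrank_eq0 mxrank_ker -lt0n subn_gt0 ltnS rank_leq_col.
pose v := nz_row (kermx M).
have v0 : v != 0 by rewrite nz_row_eq0.
have vM : v *m M = 0 by apply/sub_kermxP; exact: nz_row_sub.
pose p := \poly_(j < n.+1) v 0 (inord j).
have p0 : p != 0.
  apply: contra v0 => /eqP e; apply/eqP/rowP => j.
  have := coef_poly n.+1 (fun j => v 0 (inord j)) j.
  by rewrite -/p e coef0 ltn_ord inord_val mxE.
have pH : horner_alg H p = 0.
  rewrite /p poly_def linear_sum /=.
  under eq_bigr => j _ do rewrite linearZ /= rmorphXn /= horner_algX mulr_algl hc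
    scaler_sumr inord_val.
  rewrite exchange_big big1//= => k _.
  under eq_bigr => j _ do rewrite scalerA.
  rewrite -scaler_suml; have /rowP/(_ k) := vM; rewrite !mxE => e.
  rewrite (_ : \sum_(_ < _) _ = 0) ?scale0r// -[RHS]e.
  by apply: eq_bigr => j _; rewrite mxE.
have [s hs] := closed_field_poly_normal p.
exists s; have := pH; rewrite hs linearZ /= mulr_algl rmorph_prod /=.
under eq_bigr do rewrite rmorphB /= horner_algX horner_algC.
move=> /eqP; rewrite scaler_eq0 lead_coef_eq0 (negPf p0) => /eqP e; exact: e.
Qed.

(** If [x > r], the powers of [x / r] are unbounded by Bernoulli's inequality and eventually exceed
    [K]. *)
Lemma le_of_expn_le (x r K : R) : 0 < r ->
  (forall n, x ^+ (2 ^ n) <= K * r ^+ (2 ^ n)) -> x <= r.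
Proof.
move=> r0 h; rewrite leNgt; apply/negP => rx.
pose y := x / r - 1; have y0 : 0 < y by rewrite subr_gt0 ltr_pdivlMr ?mul1r.
have bern n : 1 + y *+ n <= (1 + y) ^+ n.
  elim: n => [|n IH]; first by rewrite mulr0n addr0.
  have y1 : 0 <= 1 + y by lra.
  have := ler_wpM2l y1 IH; rewrite -exprS; apply: le_trans.
  have : 0 <= y *+ n by rewrite mulrn_wge0 ?ltW.
  by rewrite mulrSr; nra.
have [n hn] : exists n : nat, K < y *+ n.
  have [m hm] : exists m : nat, K / y < m%:R.
    by exists (Num.bound `|K / y|); rewrite (le_lt_trans (ler_norm _))// archi_boundP.
  by exists m; move: hm; rewrite ltr_pdivrMr// mulr_natl.
have := h n; rewrite -ler_pdivrMr ?exprn_gt0// -expr_div_n leNgt.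
have -> : x / r = 1 + y by rewrite addrC subrK.
apply/negP; rewrite negbK (lt_le_trans _ (bern _))// (lt_le_trans hn)//.
rewrite ler_wpDl// -!(mulr_natr y) ler_pM2l// ler_nat.
by rewrite ltnW// ltn_expl.
Qed.

(* Iterated Cauchy-Schwarz: [|w(H)|^(2^n) <= |w(H^(2^n))| <= K r^(2^n)]. *)
Lemma state_norm_selfadjoint H : st H = H -> normc (omega H) <= nm H.
Proof.
move=> Hs; apply/ler_addgt0Pr => e e0; set r := nm H + e.
have r0 : 0 < r by rewrite ltr_wpDl ?onorm_ge0.
have Hr : nm H < r by rewrite ltrDl.
have [s hs] := annihilating_roots H.
have [|K K0 hK] := @state_power_growth H r Hr s 1; first by rewrite hs mul0r.
apply: (@le_of_expn_le _ _ K) => // n; apply: le_trans (hK _); rewrite mulr1.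
have stH m : st (H ^+ m) = H ^+ m.
  by elim: m => [|m IH]; rewrite ?expr0 ?star_one// exprS star_mul IH Hs -exprSr exprS.
elim: n => [|n IH]; first by rewrite !expr1.
rewrite expnSr !exprM (le_trans (lerXn2r 2 _ _ IH))// ?nnegrE ?exprn_ge0 ?normc_ge0//.
by have := state_Cauchy_Schwarz_normc (H ^+ (2 ^ n)); rewrite stH -expr2.
Qed.

(** Cauchy-Schwarz and the C*-identity reduce the claim to the self-adjoint element [A^* A]. *)
Lemma state_norm_le A : normc (omega A) <= nm A.
Proof.
rewrite -(@ler_pXn2r _ 2) ?nnegrE ?normc_ge0 ?onorm_ge0// -onorm_Cstar.
rewrite (le_trans (state_Cauchy_Schwarz_normc A))// state_norm_selfadjoint//.
by rewrite star_mul star_invol.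
Qed.

End States.

(** * Supports and distances *)
Section Geometry.
Variable D : nat.
Implicit Types (x y z : site D) (X Y Z : {fset site D}).

Lemma l1C x y : l1 x y = l1 y x.
Proof. by apply: eq_bigr => i _; rewrite distnC. Qed.

Lemma l1_triangle y x z : (l1 x z <= l1 x y + l1 y z)%N.
Proof. by rewrite /l1 -big_split /= leq_sum// => i _; rewrite leqD_dist. Qed.

Lemma l1_translate z x y : l1 (x + z) (y + z) = l1 x y.
Proof. by apply: eq_bigr => i _; rewrite !mxE opprD addrACA subrr addr0. Qed.

Lemma l1_sub0 x y : l1 x y = l1 (x - y) 0.
Proof. by rewrite -(l1_translate (- y)) subrr. Qed.

Lemma mem_translS X x a : a \in X -> a + x \in translS X x.
Proof. by move=> aX; apply/imfsetP; exists a. Qed.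

Lemma translSP X x b : b \in translS X x -> exists2 a, a \in X & b = a + x.
Proof. by move=> /imfsetP[a /= aX ->]; exists a. Qed.

Lemma card_translS X x : #|` translS X x| = #|` X|.
Proof. by rewrite card_imfset//; exact: addIr. Qed.

Lemma translS_sub X Y x : fsubset X Y -> fsubset (translS X x) (translS Y x).
Proof.
by move=> /fsubsetP XY; apply/fsubsetP => _ /translSP[a /XY aY ->]; exact: mem_translS.
Qed.

(** A lower bound on the distance, vacuous for empty sets. Unlike [distS] it passes directly to
    subsets and unions and needs no infinite value. *)
Definition separated X Y (k : nat) :=
  forall x y, x \in X -> y \in Y -> (k <= l1 x y)%N.

Lemma separatedW X Y X' Y' k : fsubset X X' -> fsubset Y Y' ->
  separated X' Y' k -> separated X Y k.
Proof. by move=> /fsubsetP sX /fsubsetP sY h x y /sX xX /sY; exact: h. Qed.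

Lemma separatedU X Y Z k : separated X Z k -> separated Y Z k ->
  separated (fsetU X Y) Z k.
Proof. by move=> hX hY x y; rewrite inE => /orP[/hX|/hY]; apply. Qed.

Lemma separatedC X Y k : separated X Y k -> separated Y X k.
Proof. by move=> h x y xX yY; rewrite l1C h. Qed.

Lemma closest_pair X Y : X != fset0 -> Y != fset0 ->
  exists a b, [/\ a \in X, b \in Y & separated X Y (l1 a b)].
Proof.
move=> /fset0Pn[a0 a0X] /fset0Pn[b0 b0Y].
pose P n := `[< exists a b, [/\ a \in X, b \in Y & n = l1 a b] >].
have exP : exists n, P n by exists (l1 a0 b0); apply/asboolP; exists a0, b0.
case: (ex_minnP exP) => n /asboolP[a [b [aX bY ->]]] hmin.
exists a, b; split=> // x y xX yY; apply: hmin; apply/asboolP.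
by exists x, y.
Qed.

Lemma l1_le_diamS X x y : x \in X -> y \in X -> (l1 x y <= diamS X)%N.
Proof.
rewrite /diamS => xX yX.
apply: leq_trans (leq_bigmax_seq x (F := fun x => \max_(y <- X) l1 x y)%N xX isT).
exact: (leq_bigmax_seq y (F := l1 x)).
Qed.

Lemma bigminn_le (T : eqType) (M : nat) (r : seq T) (F : T -> nat) i :
  i \in r -> (\big[minn/M]_(j <- r) F j <= F i)%N.
Proof.
elim: r => // j r IH; rewrite inE big_cons => /orP[/eqP->|/IH le].
  by rewrite geq_minl.
by rewrite (leq_trans (geq_minr _ _)).
Qed.

Lemma distS_separated X Y d : distS X Y = Some d ->
  [/\ X != fset0, Y != fset0 & separated X Y d].
Proof.
rewrite /distS; case: ifP => // /negbT; rewrite negb_or => /andP[X0 Y0] [<-].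
split=> // x y xX yY; apply: leq_trans (bigminn_le _ _ xX) _.
exact: (bigminn_le _ (l1 x) yY).
Qed.

Lemma distS_attained X Y d : distS X Y = Some d ->
  exists a b, [/\ a \in X, b \in Y & d = l1 a b].
Proof.
move=> XYd; have [X0 Y0 sd] := distS_separated XYd.
have [a [b [aX bY hab]]] := closest_pair X0 Y0.
exists a, b; split=> //; apply/eqP; rewrite eqn_leq sd //=.
move: XYd; rewrite /distS (negPf X0) (negPf Y0) /= => -[<-].
(* The default value of the minimum is the largest pairwise distance, so it never undercuts the
   closest pair. *)
set M := (\max_(x <- _) _)%N.
have hM : (l1 a b <= M)%N.
  apply: leq_trans (leq_bigmax_seq a (F := fun x => \max_(y <- Y) l1 x y)%N aX isT).
  exact: (leq_bigmax_seq b (F := l1 a)).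
have geq_min m n : (l1 a b <= m -> l1 a b <= n -> l1 a b <= minn m n)%N.
  by rewrite leq_min => -> ->.
rewrite big_seq; elim/big_ind: _ => // x xX.
by rewrite big_seq; elim/big_ind: _ => // y yY; exact: hab.
Qed.

Lemma distS_None X Y : distS X Y = None -> X = fset0 \/ Y = fset0.
Proof. by rewrite /distS; case: ifP => // /orP[/eqP|/eqP]; [left|right]. Qed.

End Geometry.

(** * Supports of local observables and clustering at a given separation *)

Section Locality.
Variables (R : realType) (D : nat) (O : algType R[i]) (Q : QLA D O).
Implicit Types (A B C : O) (X Y Z : {fset site D}).

(** A localization region [X] of least cardinality is the smallest one: for any other region [Y] the
    intersection is again a region, so by minimality it is all of [X]. *)
Lemma supp_is_supp A : is_supp (loc Q) A (supp Q A).
Proof.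
rewrite /supp /supp_of; case: pselect => [h|[]]; first exact: projT2 (cid h).
pose P n := `[< exists2 X, loc Q X A & #|` X| = n >].
have exP : exists n, P n.
  by have [X XA] := loc_cover Q A; exists #|` X|; apply/asboolP; exists X.
case: (ex_minnP exP) => n /asboolP[X XA <-] hmin.
exists X; split=> // Y YA; apply/fsetIidPl/eqP.
rewrite eqEfcard fsubsetIl; apply: hmin; apply/asboolP.
by exists (fsetI X Y) => //; apply/loc_cap.
Qed.

Lemma loc_supp A : loc Q (supp Q A) A.
Proof. by case: (supp_is_supp A). Qed.

Lemma supp_min A Y : loc Q Y A -> fsubset (supp Q A) Y.
Proof. by case: (supp_is_supp A) => _; apply. Qed.

Lemma osize_le A X : loc Q X A -> (osize Q A <= #|` X|)%N.
Proof. by move=> /supp_min/fsubset_leq_card. Qed.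

Lemma loc_transl A X x : loc Q X A -> loc Q (translS X x) (Defs.iota Q x A).
Proof.
move=> XA; apply: loc_mono (loc_supp _).
by rewrite /supp iota_supp translS_sub// supp_min.
Qed.

Lemma loc_mulU A B X Y : loc Q X A -> loc Q Y B -> loc Q (fsetU X Y) (A * B).
Proof.
by move=> XA YB; apply: loc_mul; [apply: loc_mono XA|apply: loc_mono YB];
  rewrite ?fsubsetUl ?fsubsetUr.
Qed.

Lemma separated_comm A B X Y : loc Q X A -> loc Q Y B -> separated X Y 1 ->
  A * B = B * A.
Proof.
move=> /supp_min/fsubsetP XA /supp_min/fsubsetP YB sep; apply: disj_comm.
apply/fdisjointP => x /XA xX; apply/negP => /YB /(sep _ _ xX).
by rewrite /l1 big1// => i _; rewrite subrr.
Qed.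

Variables (omega : O -> R[i]) (nu : nat -> R) (f h : nat -> R) (K : R).
Hypothesis omega_state : is_state Q omega.
Hypothesis nu_gt0 : forall l, 0 < nu l.
Hypothesis clustering : forall (l : nat) A B, (osize Q A < l)%N -> (osize Q B < l)%N ->
  normc (omega (A * B) - omega A * omega B)
    <= nu l * onorm Q A * onorm Q B * (if odist Q A B is Some d then f d else 0).
Hypothesis f_le : forall d, f d <= K * h d.
Hypothesis h_ge0 : forall d, 0 <= h d.
Hypothesis h_noninc : forall d e, (d <= e)%N -> h e <= h d.
Hypothesis K_ge0 : 0 <= K.

(** The decay [f] need not be monotone. Passing to the nonincreasing [h] allows any lower bound on
    the distance in place of its exact value. *)
Lemma separated_clustering l A B X Y k :
  loc Q X A -> loc Q Y B -> (#|` X| < l)%N -> (#|` Y| < l)%N -> separated X Y k ->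
  normc (omega (A * B) - omega A * omega B) <= nu l * K * (onorm Q A * onorm Q B * h k).
Proof.
move=> XA YB Xl Yl sep.
have /clustering/(_ _) : (osize Q A < l)%N by rewrite (leq_ltn_trans (osize_le XA)).
move=> /(_ B (leq_ltn_trans (osize_le YB) Yl)) /le_trans; apply.
have nA := onorm_ge0 Q A; have nB := onorm_ge0 Q B.
rewrite [leRHS](_ : _ = nu l * onorm Q A * onorm Q B * (K * h k)); last by ring.
rewrite ler_wpM2l ?mulr_ge0 ?(ltW (nu_gt0 l))//.
case e : (odist Q A B) => [d|]; last by rewrite mulr_ge0.
rewrite (le_trans (f_le d))// ler_wpM2l// h_noninc//.
have [a [b [aA bB ->]]] := distS_attained e.
by apply: sep; [exact: (fsubsetP (supp_min XA))|exact: (fsubsetP (supp_min YB))].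
Qed.

End Locality.

(** * Box averages *)
Section BoxAveraging.
Variables (R : realType) (D : nat).

Lemma normc_Re_le (z : R[i]) : `|complex.Re z| <= normc z.
Proof. by rewrite -lecR -normc_normE normc_ge_Re. Qed.

Lemma normc_Im_le (z : R[i]) : `|complex.Im z| <= normc z.
Proof. by case: z => a b /=; rewrite -sqrtr_sqr ler_wsqrtr// lerDr sqr_ge0. Qed.

(** Nonnegativity of a complex number means zero imaginary part and nonnegative real part, both
    closed conditions. *)
Lemma nonneg_of_approx (z : R[i]) :
  (forall e : R, 0 < e -> exists2 w : R[i], 0 <= w & normc (w - z) <= e) -> 0 <= z.
Proof.
move=> h; rewrite lecE /=; apply/andP; split.
  rewrite -normr_eq0 eq_le normr_ge0 andbT; apply/ler_addgt0Pr => e e0.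
  have [w w0 le] := h e e0; move: w0; rewrite lecE add0r => /andP[/eqP wi _].
  have := le_trans (normc_Im_le _) le; rewrite raddfB /= wi /=.
  by rewrite sub0r normrN.
apply/ler_addgt0Pr => e e0.
have [w w0 le] := h e e0; move: w0; rewrite lecE => /andP[_ /= wr].
have := le_trans (normc_Re_le _) le; rewrite raddfB /= => /(le_trans (ler_norm _)).
lra.
Qed.

Definition box (N : nat) : {fset site D} :=
  [fset x in codom (fun g : {ffun 'I_D -> 'I_(2 * N).+1} => \row_i ((g i)%:Z - N%:Z))]%fset.

Lemma boxP N (x : site D) : reflect (forall i, (`|x ord0 i| <= N)%N) (x \in box N).
Proof.
rewrite inE /=; apply: (iffP codomP) => [[g ->] i|xN].
  by rewrite mxE; case: (g i) => k /=; lia.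
exists [ffun i => inord `|(x ord0 i + N%:Z)%R|%N].
by apply/rowP => i; rewrite mxE ffunE inordK; have := xN i; move: (x ord0 i) => a; lia.
Qed.

Lemma card_box N : #|` box N| = ((2 * N).+1 ^ D)%N.
Proof.
rewrite card_fseq undup_id ?size_codom ?card_ffun ?card_ord// map_inj_uniq ?enum_uniq//.
move=> g g' /rowP e; apply/ffunP => i; apply/val_inj.
by have := e i; rewrite !mxE => /addIr[].
Qed.

Lemma subset_box (S : {fset site D}) : exists m, fsubset S (box m).
Proof.
exists (\max_(x <- enum_fset S) \max_(i < D) `|x ord0 i|)%N.
apply/fsubsetP => x xS; apply/boxP => i.
apply: leq_trans (leq_bigmax_seq x
  (F := fun x : site D => (\max_(i < D) `|x ord0 i|)%N) xS isT).
by rewrite (leq_bigmax i).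
Qed.

Lemma Bernoulli_le (t : R) n : 0 <= t <= 1 -> 1 - n%:R * t <= (1 - t) ^+ n.
Proof.
move=> /andP[t0 t1]; elim: n => [|n IH]; first by rewrite mul0r subr0.
have t1' : 0 <= 1 - t by lra.
have := ler_wpM2l t1' IH; rewrite -exprS; apply: le_trans.
by have := ler0n R n; rewrite -natr1; nra.
Qed.

(** With [V] the side of the larger box, the excess is the fraction [1 - (1 - 2m/V)^D] of it, at
    most [2mD/V] by Bernoulli's inequality. *)
Lemma box_ratio (m : nat) (e : R) : 0 < e -> exists n : nat,
  (#|` box (n + m)|%:R - #|` box n|%:R) <= e * #|` box (n + m)|%:R.
Proof.
move=> e0; pose n := Num.bound (D%:R * (2 * m%:R) / e : R); exists n.
have hn : D%:R * (2 * m%:R) < e * n%:R.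
  rewrite [ltRHS]mulrC -ltr_pdivrMr//; apply: archi_boundP.
  by rewrite divr_ge0 ?mulr_ge0 ?ler0n// ltW.
rewrite !card_box !natrX; set V := (2 * (n + m)).+1%:R : R.
have V0 : 0 < V by rewrite ltr0n.
have VE : V = 2 * n%:R + 1 + 2 * m%:R.
  by rewrite /V -natr1 natrM natrD; ring.
have t01 : 0 <= 2 * m%:R / V <= 1.
  apply/andP; split; first by rewrite divr_ge0 ?(ltW V0)// mulr_ge0.
  by rewrite ler_pdivrMr// mul1r VE; have := ler0n R n; lra.
have -> : (2 * n).+1%:R = V * (1 - 2 * m%:R / V).
  by rewrite mulrBr mulr1 mulrCA divff ?gt_eqF// mulr1 VE -natr1 natrM; ring.
rewrite exprMn -[X in X - _]mulr1 -mulrBr mulrC ler_wpM2r ?exprn_ge0 ?(ltW V0)//.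
have := Bernoulli_le D t01.
set t := _ / V => le; suff : D%:R * t <= e.
  by move: le; set u := _ * t; set v := _ ^+ D; lra.
rewrite mulrA ler_pdivrMr// (le_trans (ltW hn))// ler_pM2l// VE.
by have := ler0n R m; have := ler0n R n; lra.
Qed.

(* [\sum_(x in box) c (x - y)] is close to [z] for [y] at bounded distance inside the box,
   and the remaining [y] form a negligible fraction of a large box. *)
Lemma has_sum_nonneg (c : site D -> R[i]) (z : R[i]) (B : R) :
  has_sum c z -> (forall W : {fset site D}, normc (\sum_(x <- enum_fset W) c x) <= B) ->
  (forall W : {fset site D},
     0 <= \sum_(y <- enum_fset W) \sum_(x <- enum_fset W) c (x - y)) ->
  0 <= z.
Proof.
move=> cz cB pos; apply: nonneg_of_approx => e e0.
have e2 : 0 < e / 2 by lra.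
have [S0 hS0] := cz _ e2; have [m S0m] := subset_box S0.
(* This bounds [w y - z] for every [y]; the final 1 makes it safe to divide by. *)
pose B' := B + normc z + 1.
have B0 : 0 <= B by have := cB fset0; rewrite big_seq_fset0 normc0.
have B'0 : 0 < B' by rewrite /B'; have := normc_ge0 z; lra.
have [n hn] := box_ratio m (divr_gt0 e2 B'0).
set W := box (n + m) in hn; pose V : R := #|` W|%:R.
have V0 : 0 < V by rewrite ltr0n card_box expn_gt0.
pose w y := \sum_(x <- enum_fset W) c (x - y).
have wE y : w y = \sum_(x <- enum_fset (translS W (- y))) c x.
  by rewrite big_imfset //= => a b _ _; exact: addIr.
(* For [y] in the smaller box, the large box shifted by [-y] still contains [box m], hence [S0]. *)
have near y : y \in box n -> normc (w y - z) <= e / 2.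
  move=> yn; rewrite -lecR -normc_normE ltW// wE; apply: hS0.
  apply/fsubsetP => x /(fsubsetP S0m)/boxP xm.
  rewrite -[x](addrK y); apply: mem_translS; apply/boxP => i; rewrite mxE.
  move/boxP : yn => /(_ i); have := xm i; move: (x ord0 i) (y ord0 i) => a b; lia.
have far y : normc (w y - z) <= B'.
  rewrite (le_trans (le_normcD _ _))// normcN /B' wE.
  by have := cB (translS W (- y)); lra.
exists (V^-1%:C%C * \sum_(y <- enum_fset W) w y).
  by rewrite mulr_ge0// ler0c invr_ge0 ltW.
have sumz : V%:C%C * z = \sum_(y <- enum_fset W) z.
  rewrite big_const_seq count_predT iter_addr_0 /V.
  by rewrite rmorph_nat mulr_natl.
have -> : V^-1%:C%C * \sum_(y <- enum_fset W) w y - z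
    = V^-1%:C%C * \sum_(y <- enum_fset W) (w y - z).
  rewrite sumrB mulrBr -sumz mulrA -rmorphM mulVf ?gt_eqF// rmorph1 mul1r.
  by [].
rewrite normcM normc_real ger0_norm ?invr_ge0 ?(ltW V0)// mulrC ler_pdivrMr//.
rewrite (le_trans (le_normc_sum _ _ _))//.
have sub : fsubset (box n) W.
  apply/fsubsetP => x /boxP xn; apply/boxP => i.
  by rewrite (leq_trans (xn i))// leq_addr.
rewrite (big_fset_split _ sub) /=.
(* The error budget: [e / 2] for each site near the centre, and [B'] for each of the at most
   [e / 2 / B' * V] remaining sites. *)
have -> : e * V = V * (e / 2) + e / 2 / B' * V * B'.
  by rewrite mulrAC divfK ?gt_eqF//; lra.
apply: lerD.
  apply: le_trans (_ : \sum_(y <- box n) (e / 2) <= _).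
    by rewrite big_seq [leRHS]big_seq; apply: ler_sum.
  rewrite big_const_seq count_predT iter_addr_0 -[leLHS]mulr_natl ler_pM2r//.
  by rewrite ler_nat fsubset_leq_card.
apply: le_trans (_ : \sum_(y <- (W `\` box n)%fset) B' <= _).
  by apply: ler_sum.
rewrite big_const_seq count_predT iter_addr_0 -[leLHS]mulr_natl ler_pM2r//.
by rewrite [X in X%:R](cardfsDS sub) natrB ?fsubset_leq_card.
Qed.

End BoxAveraging.

(** * The form of a clustering state *)
Section PairSums.
Variables (R : realType) (D : nat).
Implicit Types (s : nat -> R) (X Y W : {fset site D}).

(** Summing over all pairs of sites dominates the term of the closest pair, which varies with [x],
    by an expression that is easily summed over [x]. *)
Definition pairsum s X Y (x : site D) : R :=
  \sum_(a <- enum_fset X) \sum_(b <- enum_fset Y) s (l1 (a + x) b).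

Lemma pairsum_ge0 s X Y x : (forall d, 0 <= s d) -> 0 <= pairsum s X Y x.
Proof. by move=> s0; do 2!apply: sumr_ge0 => ? _. Qed.

Lemma le_pairsum s X Y x a b : (forall d, 0 <= s d) -> a \in X -> b \in Y ->
  s (l1 (a + x) b) <= pairsum s X Y x.
Proof.
move=> s0 aX bY; rewrite /pairsum (big_fsetD1 a aX) /= (big_fsetD1 b bY) /= -addrA.
by rewrite lerDl addr_ge0 ?sumr_ge0// => i _; rewrite sumr_ge0.
Qed.

(** For a fixed pair [a], [b] the sum over [x] is a lattice sum translated by [a - b]. *)
Lemma sum_pairsum_le s (S : R) X Y W :
  (forall V : {fset site D}, \sum_(x <- enum_fset V) s (l1 x 0) <= S) ->
  \sum_(x <- enum_fset W) pairsum s X Y x <= #|` X|%:R * #|` Y|%:R * S.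
Proof.
move=> sS; rewrite exchange_big /=.
apply: le_trans (_ : \sum_(a <- enum_fset X) \sum_(b <- enum_fset Y) S <= _).
  apply: ler_sum => a _; rewrite exchange_big /=; apply: ler_sum => b _.
  apply: le_trans (sS (translS W (a - b))).
  rewrite big_imfset /=; last by move=> x y _ _; exact: addIr.
  apply: ler_sum => x _; rewrite l1_sub0 [X in l1 X](_ : _ = x + (a - b))//.
  by rewrite [a + x]addrC addrA.
rewrite !big_const_seq !count_predT !iter_addr_0.
by rewrite -mulrA !mulr_natl.
Qed.

End PairSums.

(** * Covariances, third cumulants and the form *)

Section Cumulants.
Variables (R : realType) (D : nat) (O : algType R[i]) (Q : QLA D O).
Implicit Types (A B C : O) (X Y Z : {fset site D}).
Variables (omega : O -> R[i]) (nu h : nat -> R).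
Hypothesis omega_inv : transl_inv_state Q omega.
Local Notation nm := (onorm Q).
Local Notation st := (star Q).
Local Notation tr := (Defs.iota Q).

Let omega_state : is_state Q omega. Proof. by case: omega_inv. Qed.
Let omega_transl x A : omega (tr x A) = omega A. Proof. by case: omega_inv. Qed.

Definition cov A B := omega (A * B) - omega A * omega B.

(** The third joint cumulant, with the order of the operators kept. *)
Definition cum3 A B C := omega (A * (B * C)) - omega A * omega (B * C)
  - omega (A * B) * omega C - omega (A * C) * omega B
  + 2 * (omega A * omega B * omega C).

Hypothesis nu_ge0 : forall l, 0 <= nu l.
Hypothesis h_ge0 : forall d, 0 <= h d.
Hypothesis cov_separated : forall l A B X Y k,
  loc Q X A -> loc Q Y B -> (#|` X| < l)%N -> (#|` Y| < l)%N -> separated X Y k ->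
  normc (cov A B) <= nu l * (nm A * nm B * h k).

(** Empty support means a scalar; this settles the cases where no closest pair of sites exists. *)
Lemma cov_scalarl A B : loc Q fset0 A -> cov A B = 0.
Proof.
move=> /loc_empty[c ->]; rewrite /cov mulr_algl !(stateZ omega_state).
by rewrite (state_one omega_state) mulr1 subrr.
Qed.

Lemma cov_scalarr A B : loc Q fset0 B -> cov A B = 0.
Proof.
move=> /loc_empty[c ->]; rewrite /cov mulr_algr !(stateZ omega_state).
by rewrite (state_one omega_state) mulr1 mulrC subrr.
Qed.

(** Every covariance on the right crosses the cut between [A] and the pair [B], [C]; in [cum3_right]
    the cut isolates [C]. *)
Lemma cum3_left A B C :
  cum3 A B C = cov A (B * C) - cov A B * omega C - cov A C * omega B.
Proof. by rewrite /cum3 /cov; ring. Qed.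

Lemma cum3_right A B C :
  cum3 A B C = cov (A * B) C - cov B C * omega A - cov A C * omega B.
Proof. by rewrite /cum3 /cov -(mulrA A); ring. Qed.

(** Contractivity of the state enters the cumulant estimates here. *)
Lemma normc_mul_state_le (z : R[i]) (r : R) A : normc z <= r ->
  normc (z * omega A) <= r * nm A.
Proof.
move=> zr; rewrite normcM ler_pM ?normc_ge0//.
exact: (state_norm_le omega_state).
Qed.

Lemma le_normcB3 (x y z : R[i]) (r : R) : normc x <= r -> normc y <= r ->
  normc z <= r -> normc (x - y - z) <= 3 * r.
Proof.
move=> hx hy hz; rewrite (le_trans (le_normcD _ _))// normcN.
by have := le_normcD x (- y); rewrite normcN; lra.
Qed.

Lemma cum3_le_left l A B C X Y Z k : loc Q X A -> loc Q Y B -> loc Q Z C ->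
  (#|` X| < l)%N -> (#|` Y `|` Z|%fset < l)%N ->
  separated X (Y `|` Z)%fset k ->
  normc (cum3 A B C) <= 3 * (nu l * (nm A * nm B * nm C * h k)).
Proof.
move=> XA YB ZC Xl YZl sep; rewrite cum3_left.
have Yl : (#|` Y| < l)%N by rewrite (leq_ltn_trans _ YZl)// fsubset_leq_card ?fsubsetUl.
have Zl : (#|` Z| < l)%N by rewrite (leq_ltn_trans _ YZl)// fsubset_leq_card ?fsubsetUr.
have sY := separatedW (fsubset_refl X) (fsubsetUl Y Z) sep.
have sZ := separatedW (fsubset_refl X) (fsubsetUr Y Z) sep.
apply: le_normcB3.
- apply: le_trans (cov_separated XA (loc_mulU YB ZC) Xl YZl sep) _.
  rewrite ler_wpM2l// ler_wpM2r// -mulrA ler_wpM2l ?onorm_ge0//.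
  exact: onorm_submul.
- apply: le_trans (normc_mul_state_le C (cov_separated XA YB Xl Yl sY)) _.
  by rewrite le_eqVlt; apply/orP; left; apply/eqP; ring.
- apply: le_trans (normc_mul_state_le B (cov_separated XA ZC Xl Zl sZ)) _.
  by rewrite le_eqVlt; apply/orP; left; apply/eqP; ring.
Qed.

Lemma cum3_le_right l A B C X Y Z k : loc Q X A -> loc Q Y B -> loc Q Z C ->
  (#|` X `|` Y|%fset < l)%N -> (#|` Z| < l)%N ->
  separated (X `|` Y)%fset Z k ->
  normc (cum3 A B C) <= 3 * (nu l * (nm A * nm B * nm C * h k)).
Proof.
move=> XA YB ZC XYl Zl sep; rewrite cum3_right.
have Xl : (#|` X| < l)%N by rewrite (leq_ltn_trans _ XYl)// fsubset_leq_card ?fsubsetUl.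
have Yl : (#|` Y| < l)%N by rewrite (leq_ltn_trans _ XYl)// fsubset_leq_card ?fsubsetUr.
have sX := separatedW (fsubsetUl X Y) (fsubset_refl Z) sep.
have sY := separatedW (fsubsetUr X Y) (fsubset_refl Z) sep.
apply: le_normcB3.
- apply: le_trans (cov_separated (loc_mulU XA YB) ZC XYl Zl sep) _.
  rewrite ler_wpM2l// ler_wpM2r// ler_wpM2r ?onorm_ge0//.
  exact: onorm_submul.
- apply: le_trans (normc_mul_state_le A (cov_separated YB ZC Yl Zl sY)) _.
  by rewrite le_eqVlt; apply/orP; left; apply/eqP; ring.
- apply: le_trans (normc_mul_state_le B (cov_separated XA ZC Xl Zl sX)) _.
  by rewrite le_eqVlt; apply/orP; left; apply/eqP; ring.
Qed.

Lemma omega_star_transl x A : omega (st (tr x A)) = omega (st A).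
Proof. by rewrite -iota_star omega_transl. Qed.

Lemma onorm_star_transl x A : nm (st (tr x A)) = nm A.
Proof. by rewrite onorm_star iota_norm. Qed.

Lemma loc_star_transl x A X : loc Q X A -> loc Q (translS X x) (st (tr x A)).
Proof. by move=> /(loc_transl x)/loc_star. Qed.

Lemma cov_transl_le l A B x : (osize Q A < l)%N -> (osize Q B < l)%N ->
  normc (cov (st (tr x A)) B)
    <= nu l * (nm A * nm B * pairsum h (supp Q A) (supp Q B) x).
Proof.
move=> Al Bl; have lA := loc_star_transl x (loc_supp Q A); have lB := loc_supp Q B.
have rhs0 : 0 <= nu l * (nm A * nm B * pairsum h (supp Q A) (supp Q B) x).
  by rewrite !mulr_ge0 ?onorm_ge0// pairsum_ge0.
have [A0|A0] := eqVneq (translS (supp Q A) x) fset0.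
  by rewrite cov_scalarl ?normc0// -A0.
have [B0|B0] := eqVneq (supp Q B) fset0; first by rewrite cov_scalarr ?normc0// -B0.
have [_ [b [/translSP[a aA ->] bB sep]]] := closest_pair A0 B0.
apply: le_trans (cov_separated lA lB _ Bl sep) _; first by rewrite card_translS.
rewrite onorm_star_transl ler_wpM2l// ler_wpM2l ?mulr_ge0 ?onorm_ge0//.
exact: le_pairsum.
Qed.

(** * Convergence of the defining sum and algebraic properties of the form *)

Variable Sh : R.
Hypothesis sum_h : forall V : {fset site D}, \sum_(x <- enum_fset V) h (l1 x 0) <= Sh.

Let Sh_ge0 : 0 <= Sh.
Proof. by have := sum_h fset0; rewrite big_seq_fset0. Qed.

Lemma sum_cov_transl_le l A B (W : {fset site D}) :
  (osize Q A < l)%N -> (osize Q B < l)%N ->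
  \sum_(x <- enum_fset W) normc (cov (st (tr x A)) B)
    <= nu l * (l%:R * l%:R * Sh) * nm A * nm B.
Proof.
move=> Al Bl; apply: le_trans (ler_sum _ (fun x _ => cov_transl_le x Al Bl)) _.
rewrite -!mulr_sumr [leRHS](_ : _ = nu l * (nm A * nm B * (l%:R * l%:R * Sh))); last by ring.
rewrite ler_wpM2l// ler_wpM2l ?mulr_ge0 ?onorm_ge0//.
apply: le_trans (sum_pairsum_le _ _ _ sum_h) _.
by rewrite ler_wpM2r// ler_pM// ler_nat ltnW.
Qed.

Lemma GNS_sum_exists : exists form : O -> O -> R[i], is_GNS_sum_form Q omega form.
Proof.
have ex (p : O * O) : exists z, has_sum (fun x => cov (st (tr x p.1)) p.2) z.
  pose l := (maxn (osize Q p.1) (osize Q p.2)).+1.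
  apply: abs_has_sum => W.
  by apply: (@sum_cov_transl_le l); rewrite ltnS ?leq_maxl ?leq_maxr.
have [F hF] := choice ex; exists (fun A B => F (A, B)) => A B.
apply: has_sum_eq (hF (A, B)) => x /=.
by rewrite /cov omega_star_transl.
Qed.

Variable form : O -> O -> R[i].
Hypothesis form_GNS : is_GNS_sum_form Q omega form.

Lemma form_has_sum A B : has_sum (fun x => cov (st (tr x A)) B) (form A B).
Proof.
by apply: has_sum_eq (form_GNS A B) => x; rewrite /cov omega_star_transl.
Qed.

Lemma form_transl x A B : form (tr x A) (tr x B) = form A B.
Proof.
apply: has_sum_unique (form_has_sum _ _) _; apply: has_sum_eq (form_has_sum A B) => y.
rewrite /cov !omega_star_transl omega_transl iota_comp (addrC y) -iota_comp -(iota_star Q x).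
by rewrite -iota_mul omega_transl.
Qed.

Lemma form_linl (a : R[i]) A B C : form (a *: A + B) C = conjc a * form A C + form B C.
Proof.
apply: has_sum_unique (form_has_sum _ _) _.
apply: has_sum_eq (has_sumD (has_sumZ (conjc a) (form_has_sum A C)) (form_has_sum B C)) => x.
rewrite /cov iota_lin star_lin mulrDl -scalerAl !(stateD omega_state) !(stateZ omega_state).
by ring.
Qed.

Lemma form_linr (a : R[i]) A B C : form A (a *: B + C) = a * form A B + form A C.
Proof.
apply: has_sum_unique (form_has_sum _ _) _.
apply: has_sum_eq (has_sumD (has_sumZ a (form_has_sum A B)) (form_has_sum A C)) => x.
rewrite /cov (mulrDr (st _)) -scalerAr !(stateD omega_state) !(stateZ omega_state).
by ring.
Qed.

Lemma form_scalar A (a : R[i]) : form A a%:A = 0.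
Proof.
apply: has_sum_unique (form_has_sum _ _) _; apply: has_sum_eq (@has_sum0 R D) => x.
by rewrite cov_scalarr//; apply/loc_empty; exists a.
Qed.

Lemma form_scaler (a : R[i]) A B : form A (a *: B) = a * form A B.
Proof. by have := form_linr a A B 0%:A; rewrite form_scalar scale0r !addr0. Qed.

Lemma state_scalar (a : R[i]) : omega a%:A = a.
Proof. by rewrite (stateZ omega_state) (state_one omega_state) mulr1. Qed.

Lemma form_normc_le l A B : (osize Q A < l)%N -> (osize Q B < l)%N ->
  normc (form A B) <= nu l * (l%:R * l%:R * Sh) * nm A * nm B.
Proof.
move=> Al Bl; apply: has_sum_normc_le (form_has_sum A B) _ => W.
exact: le_trans (le_normc_sum _ _ _) (sum_cov_transl_le W Al Bl).
Qed.

Lemma form_pos A : 0 <= form A A.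
Proof.
pose l := (osize Q A).+1.
apply: (has_sum_nonneg (form_has_sum A A)) => [W|W].
  exact: le_trans (le_normc_sum _ _ _) (@sum_cov_transl_le l _ _ W (ltnSn _) (ltnSn _)).
pose G := \sum_(x <- enum_fset W) tr x A.
(* By translation invariance the double sum is the variance of [G], the sum of the translates of [A]
   over [W]. *)
have -> : \sum_(y <- enum_fset W) \sum_(x <- enum_fset W) cov (st (tr (x - y) A)) A
    = cov (st G) G.
  rewrite /cov /G star_sum mulr_suml !(state_sum omega_state) mulr_suml exchange_big /=.
  rewrite -sumrB; apply: eq_bigr => x _.
  rewrite mulr_sumr (state_sum omega_state) mulr_sumr -sumrB; apply: eq_bigr => y _.
  rewrite !omega_star_transl omega_transl -[X in X - _](omega_transl y) iota_mul iota_star.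
  by rewrite iota_comp [y + _]addrC subrK.
by rewrite subr_ge0 (state_Cauchy_Schwarz omega_state).
Qed.

Lemma form_defect_has_sum A B C : has_sum (fun x => cum3 (st (tr x A)) B C)
  (form A (B * C) - form A B * omega C - form A C * omega B).
Proof.
have -> : form A (B * C) - form A B * omega C - form A C * omega B
  = form A (B * C) + (- omega C) * form A B + (- omega B) * form A C by ring.
have := has_sumD (has_sumD (form_has_sum A (B * C))
  (has_sumZ (- omega C) (form_has_sum A B))) (has_sumZ (- omega B) (form_has_sum A C)).
by apply: has_sum_eq => x; rewrite cum3_left; ring.
Qed.

(** * Clustering of the form, by interpolating between two bounds on the cumulant *)

Variables (s t : nat -> R) (Ss : R).
Hypothesis s_ge0 : forall d, 0 <= s d.
Hypothesis t_ge0 : forall d, 0 <= t d.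
Hypothesis h_interp : forall d e (r : R), r <= h d -> r <= h e -> r <= t d * s e.
Hypothesis sum_s : forall V : {fset site D}, \sum_(x <- enum_fset V) s (l1 x 0) <= Ss.

Let Ss_ge0 : 0 <= Ss.
Proof. by have := sum_s fset0; rewrite big_seq_fset0. Qed.

(** If the translate of [X] came closer than [uphalf n] to both sets, the triangle inequality
    through it would put them at distance at most [diamS X + 2 (uphalf n - 1)], less than
    [diamS X + n]. *)
Lemma separated_dichotomy X Y Z n : separated Y Z (diamS X + n) -> (0 < n)%N ->
  forall x, separated (translS X x) Y (uphalf n) \/ separated (translS X x) Z (uphalf n).
Proof.
move=> sep n0 x; have [|] := pselect (separated (translS X x) Y (uphalf n)); first by left.
move=> nY; right => _ z /translSP[a aX ->] zZ; rewrite leqNgt; apply/negP => lt1; apply: nY.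
move=> _ y /translSP[b bX ->] yY; rewrite leqNgt; apply/negP => lt2.
have := sep y z yY zZ.
have := l1_triangle (b + x) y z; have := l1_triangle (a + x) (b + x) z.
rewrite l1_translate (l1C y (b + x)); have := l1_le_diamS bX aX.
have : (2 * uphalf n <= n.+1)%N by rewrite uphalf_half; have := odd_double_half n; lia.
lia.
Qed.

Lemma cum3_transl_le l A B C n x :
  (osize Q A < l)%N -> (osize Q B < l)%N -> (osize Q C < l)%N ->
  separated (supp Q B) (supp Q C) (odiam Q A + n) -> (0 < n)%N ->
  normc (cum3 (st (tr x A)) B C)
    <= 3 * (nu (2 * l) * (nm A * nm B * nm C
        * (t (uphalf n) * pairsum s (supp Q A) (supp Q B `|` supp Q C)%fset x))).
Proof.
move=> Al Bl Cl sep n0; set A' := st (tr x A); set N := nm A * nm B * nm C.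
have N0 : 0 <= N by rewrite !mulr_ge0 ?onorm_ge0.
have lA : loc Q (translS (supp Q A) x) A' := loc_star_transl x (loc_supp Q A).
have lB := loc_supp Q B; have lC := loc_supp Q C.
(* Unions of two supports have fewer than [2 * l] sites, whence [nu (2 * l)]. *)
have cU U V : (#|` U| < l)%N -> (#|` V| < l)%N ->
    (#|` U `|` V : {fset site D}|%fset < 2 * l)%N.
  by move=> hU hV; rewrite (leq_ltn_trans (leq_card_fsetU _ _))//; lia.
have cA : (#|` translS (supp Q A) x| < l)%N by rewrite card_translS.
have l2 U : (#|` U : {fset site D}| < l)%N -> (#|` U| < 2 * l)%N by lia.
have rhs0 : 0 <= 3 * (nu (2 * l) * (N * (t (uphalf n)
    * pairsum s (supp Q A) (supp Q B `|` supp Q C)%fset x))).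
  by rewrite !mulr_ge0 ?onorm_ge0 ?pairsum_ge0.
have far : normc (cum3 A' B C) <= 3 * (nu (2 * l) * (N * h (uphalf n))).
  rewrite /N -(onorm_star_transl x A).
  (* The observable split off must be far from the other two; [B] and [C] are already far from each
     other. *)
  have half : separated (supp Q B) (supp Q C) (uphalf n).
    by move=> b c bB cC; apply: leq_trans (sep b c bB cC); rewrite uphalf_half; lia.
  have [sB|sC] := separated_dichotomy sep n0 x.
    (* When [B] is the far one it is moved into last position, since [B] and [C] have disjoint
       supports and commute. *)
    have -> : cum3 A' B C = cum3 A' C B.
      have BC : B * C = C * B.
        apply: separated_comm lB lC _ => b c bB cC.
        by rewrite (leq_trans _ (half b c bB cC))// uphalf_gt0.
      by rewrite /cum3 BC; ring.
    rewrite [X in nu _ * (X * _)]mulrAC.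
    apply: (cum3_le_right lA lC lB); [exact: cU|exact: l2|].
    by apply: separatedU => //; exact: separatedC.
  apply: (cum3_le_right lA lB lC); [exact: cU|exact: l2|].
  by apply: separatedU.
have [A0|A0] := eqVneq (translS (supp Q A) x) fset0.
  by rewrite cum3_left !cov_scalarl -?A0// !mul0r !subr0 normc0.
have [B0|B0] := eqVneq (supp Q B `|` supp Q C)%fset fset0.
  have e0 U : fsubset U (supp Q B `|` supp Q C)%fset -> U = fset0.
    by rewrite B0 fsubset0 => /eqP.
  rewrite cum3_right [cov _ C]cov_scalarr -?(e0 _ (fsubsetUr _ _))//.
  rewrite [cov _ C]cov_scalarr -?(e0 _ (fsubsetUr _ _))//.
  rewrite [cov _ C]cov_scalarr -?(e0 _ (fsubsetUr _ _))//.
  by rewrite !mul0r !subr0 normc0.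
have [_ [b [/translSP[a aA ->] bB near_sep]]] := closest_pair A0 B0.
have near : normc (cum3 A' B C) <= 3 * (nu (2 * l) * (N * h (l1 (a + x) b))).
  rewrite /N -(onorm_star_transl x A).
  by apply: (cum3_le_left lA lB lC); [exact: l2|exact: cU|].
set c := 3 * nu (2 * l) * N.
have c0 : 0 <= c by rewrite !mulr_ge0 ?onorm_ge0.
have cE (r : R) : 3 * (nu (2 * l) * (N * r)) = c * r by rewrite /c !mulrA.
rewrite cE in far; rewrite cE in near; rewrite cE.
(* The interpolation hypothesis speaks of [h] without a prefactor, so the common constant is divided
   out; if it is zero, the bound [far] already suffices. *)
have [cp|cn] := ltP 0 c; last first.
  have {}c0 : c = 0 by apply: le_anti; rewrite cn.
  by move: far; rewrite c0 !mul0r.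
rewrite mulrC -ler_pdivrMr// in far; rewrite mulrC -ler_pdivrMr// in near.
rewrite mulrC -ler_pdivrMr//; apply: le_trans (h_interp far near) _.
by rewrite ler_wpM2l// le_pairsum.
Qed.

Lemma form_defect_le l A B C n :
  (osize Q A < l)%N -> (osize Q B < l)%N -> (osize Q C < l)%N ->
  separated (supp Q B) (supp Q C) (odiam Q A + n) -> (0 < n)%N ->
  normc (form A (B * C) - form A B * omega C - form A C * omega B)
    <= 3 * nu (2 * l) * (l%:R * (2 * l)%:R * Ss) * (nm A * nm B * nm C) * t (uphalf n).
Proof.
move=> Al Bl Cl sep n0; apply: has_sum_normc_le (form_defect_has_sum A B C) _ => W.
apply: le_trans (le_normc_sum _ _ _) _.
apply: le_trans (ler_sum _ (fun x _ => cum3_transl_le x Al Bl Cl sep n0)) _.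
rewrite -!mulr_sumr [leRHS](_ : _ = 3 * (nu (2 * l) * (nm A * nm B * nm C
  * (t (uphalf n) * (l%:R * (2 * l)%:R * Ss))))); last by ring.
rewrite ler_wpM2l// ler_wpM2l// ler_wpM2l ?mulr_ge0 ?onorm_ge0// ler_wpM2l//.
apply: le_trans (sum_pairsum_le _ _ _ sum_s) _.
rewrite ler_wpM2r// ler_pM// ler_nat; first exact: ltnW.
by rewrite (leq_trans (leq_card_fsetU _ _))// mul2n -addnn leq_add// ltnW.
Qed.

Variables (g : nat -> R) (Kg : R).
Hypothesis g_gt0 : forall n, (0 < n)%N -> 0 < g n.
Hypothesis t_le : forall n, (0 < n)%N -> t (uphalf n) <= Kg * g n.
Hypothesis Kg_ge0 : 0 <= Kg.

Lemma form_clustering : clustering_form Q omega form g.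
Proof.
split; first exact: form_transl.
split; first exact: form_linl.
split; first exact: form_linr.
split; first exact: form_pos.
pose kappa l := nu l * (l%:R * l%:R * Sh).
have kappa0 l : 0 <= kappa l by rewrite !mulr_ge0.
have fk l A B : (osize Q A < l)%N -> (osize Q B < l)%N ->
    normc (form A B) <= kappa l * nm A * nm B by exact: form_normc_le.
split; last first.
  move=> l l0; exists (kappa l + 1); split=> [|A B Al Bl].
    by rewrite ltr_wpDl.
  rewrite normc_normE lecR (le_trans (fk _ _ _ Al Bl))//.
  by rewrite ler_wpM2r ?onorm_ge0// ler_wpM2r ?onorm_ge0// lerDl.
pose c1 l := 3 * nu (2 * l) * (l%:R * (2 * l)%:R * Ss) * Kg.
have c10 l : 0 <= c1 l by rewrite !mulr_ge0.
(* The term [c1] serves distances beyond the diameter of [A], the term in [kappa] all smaller ones,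
   and 1 ensures positivity. The decay function is [g] on positive integers and 1 elsewhere. *)
exists (fun l => c1 l + 3 * kappa (2 * l) + 1),
  (fun z : int => if z is Posz n.+1 then g n.+1 else 1).
split; first by move=> l; rewrite ltr_wpDl// addr_ge0// mulr_ge0.
split; first by move=> [[|n]|n]; rewrite ?g_gt0.
split; first by move=> [|n].
move=> l A B C Al Bl Cl; rewrite normc_normE lecR.
set N := nm A * nm B * nm C; have N0 : 0 <= N by rewrite !mulr_ge0 ?onorm_ge0.
rewrite -!mulrA [nm A * _]mulrA [_ * (nm C * _)]mulrA -/N.
(* At infinite distance the right side is 0; then [B] or [C] is a scalar, and the defect vanishes
   because the form kills scalars. *)
case e : (odist Q B C) => [d|] /=; last first.
  rewrite !mulr0.
  have [B0|C0] := distS_None e.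
    have := loc_supp Q B; rewrite B0 => /loc_empty[a ->].
    by rewrite mulr_algl form_scaler form_scalar state_scalar mul0r subr0 mulrC subrr normc0.
  have := loc_supp Q C; rewrite C0 => /loc_empty[a ->].
  by rewrite mulr_algr form_scaler form_scalar state_scalar mul0r subr0 mulrC subrr normc0.
have [_ _ sep] := distS_separated e.
(* Without separation beyond the diameter, boundedness of each of the three terms is enough. *)
have [le|lt] := leqP d (odiam Q A).
  have -> : (if d%:Z - (odiam Q A)%:Z is Posz n.+1 then g n.+1 else 1) = 1 :> R.
    by case E : (d%:Z - (odiam Q A)%:Z) => [[|n]|n] //; lia.
  have two m : (m < l)%N -> (m < 2 * l)%N by lia.
  have BC : (osize Q (B * C) < 2 * l)%N.
    apply: leq_ltn_trans (osize_le (loc_mulU (loc_supp Q B) (loc_supp Q C))) _.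
    apply: leq_ltn_trans (leq_card_fsetU _ _) _.
    by move: Bl Cl; rewrite /osize; lia.
  apply: le_trans (_ : 3 * (kappa (2 * l) * N) <= _).
    apply: le_normcB3.
    - apply: le_trans (fk _ _ _ (two _ Al) BC) _.
      rewrite -mulrA ler_wpM2l// /N -mulrA ler_wpM2l ?onorm_ge0//.
      exact: onorm_submul.
    - apply: le_trans (normc_mul_state_le C (fk _ _ _ (two _ Al) (two _ Bl))) _.
      by rewrite !mulrA.
    - apply: le_trans (normc_mul_state_le B (fk _ _ _ (two _ Al) (two _ Cl))) _.
      by rewrite le_eqVlt; apply/orP; left; apply/eqP; rewrite /N; ring.
  rewrite mulr1 mulrA ler_wpM2r// -addrA addrCA lerDl addr_ge0//.
have [n n0 dE] : exists2 n, (0 < n)%N & d = (odiam Q A + n)%N.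
  by exists (d - odiam Q A)%N; [rewrite subn_gt0|rewrite subnKC// ltnW].
rewrite dE in sep *.
have -> : (if (odiam Q A + n)%N%:Z - (odiam Q A)%:Z is Posz n.+1 then g n.+1 else 1) = g n.
  by rewrite PoszD addrAC subrr add0r; case: n n0 {dE sep}.
apply: le_trans (form_defect_le Al Bl Cl sep n0) _; rewrite -/N.
apply: le_trans (_ : c1 l * (N * g n) <= _); last first.
  rewrite /= ler_wpM2r ?(mulr_ge0 N0 (ltW (g_gt0 n0)))// -addrA lerDl.
  by rewrite addr_ge0 ?mulr_ge0.
rewrite /c1; set c := 3 * _ * _; have c0 : 0 <= c by rewrite !mulr_ge0.
rewrite [leRHS](_ : _ = c * N * (Kg * g n)); last by ring.
by rewrite ler_wpM2l ?(mulr_ge0 c0 N0)// t_le.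
Qed.

End Cumulants.

(** * Polynomial and exponential decay rates *)

Section ClusteringStates.
Variables (R : realType) (D : nat) (O : algType R[i]) (Q : QLA D O).
Variable omega : O -> R[i].

Lemma clustering_state_cov (g h : nat -> R) (K : R) :
  clustering_state Q omega g -> (forall d, 0 < h d) ->
  (forall d e, (d <= e)%N -> h e <= h d) ->
  (forall d, (0 < d)%N -> g d <= K * h d) ->
  exists2 nu : nat -> R, forall l, 0 <= nu l &
    forall l A B X Y k, loc Q X A -> loc Q Y B ->
      (#|` X| < l)%N -> (#|` Y| < l)%N -> separated X Y k ->
      normc (cov omega A B) <= nu l * (onorm Q A * onorm Q B * h k).
Proof.
move=> [[st _] [nu [f [nu0 [f0 [fg hcl]]]]]] h0 hn gK.
(* The first summand handles positive distances, the second distance 0, where [g] does not control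
   [f]. *)
pose K' := `|K| + f 0 / h 0%N.
have K'0 : 0 <= K' by rewrite addr_ge0// divr_ge0// ltW.
exists (fun l => nu l * K') => [l|l A B X Y k XA YB Xl Yl sep].
  by rewrite mulr_ge0// ltW.
apply: (@separated_clustering _ _ _ Q omega nu (fun d => f d%:Z) h K') sep => //.
- move=> l' A' B' Al Bl; have := hcl l' A' B' Al Bl.
  by rewrite normc_normE lecR; case: (odist Q A' B').
- move=> [|d]; rewrite mulrDl.
    by rewrite divfK ?gt_eqF// lerDr mulr_ge0// ltW.
  apply: le_trans (fg _ _) (le_trans (gK _ _) _) => //.
  apply: ler_wpDr; first by rewrite mulr_ge0 ?divr_ge0 ?(ltW (f0 _)) ?(ltW (h0 _)).
  by rewrite ler_wpM2r ?ler_norm ?(ltW (h0 _)).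
- by move=> d; exact: ltW.
Qed.

(** The larger of [d] and [e] gives the better bound: lower its argument to [d] in [t], or to [e] in
    [s], by monotonicity. *)
Lemma decay_interpolation (h s t : nat -> R) :
  (forall d, h d = t d * s d) -> (forall d, 0 <= s d) -> (forall d, 0 <= t d) ->
  (forall d e, (d <= e)%N -> s e <= s d) -> (forall d e, (d <= e)%N -> t e <= t d) ->
  forall d e (r : R), r <= h d -> r <= h e -> r <= t d * s e.
Proof.
move=> hE s0 t0 sn tn d e r rd re; have [le|/ltnW le] := leqP d e.
  by apply: le_trans re _; rewrite hE ler_wpM2r// tn.
by apply: le_trans rd _; rewrite hE ler_wpM2l// sn.
Qed.

Lemma powR_succ_noninc (a : R) : 0 <= a -> forall d e, (d <= e)%N ->
  powR e.+1%:R (- a) <= powR d.+1%:R (- a).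
Proof.
move=> a0 d e de; rewrite !powRN lef_pV2 ?posrE ?powR_gt0//.
by rewrite ge0_ler_powR ?nnegrE ?ler_nat.
Qed.

Lemma expR_noninc (a : R) : 0 <= a -> forall d e, (d <= e)%N ->
  expR (- (a * e%:R)) <= expR (- (a * d%:R)).
Proof. by move=> a0 d e de; rewrite ler_expR lerN2 ler_wpM2l ?ler_nat. Qed.

(** Doubling the argument costs a factor [2^a]. This absorbs both the shift from [d] to [d + 1] and
    the halving of [n]. *)
Lemma powR_scale_le (a : R) (m n k : nat) : 0 <= a -> (0 < m)%N -> (0 < k)%N ->
  (k <= 2 * m)%N -> powR m%:R (- a) <= powR 2 a * powR k%:R (- a).
Proof.
move=> a0 m0 k0 km; rewrite !powRN ler_pdivlMr ?powR_gt0 ?ltr0n//.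
rewrite mulrC ler_pdivrMr ?powR_gt0 ?ltr0n// -powRM// -natrM.
by rewrite ge0_ler_powR ?nnegrE ?ler_nat.
Qed.

End ClusteringStates.

Theorem theorem4p9 (R : realType) (D : nat) (O : algType R[i]) (Q : QLA D O)
  (omega : O -> R[i]) :
  (forall p : R, 2 * D%:R < p -> alg_clustering_state Q omega p ->
     exists form : O -> O -> R[i], is_GNS_sum_form Q omega form /\
       forall q : R, D%:R < q -> q < p - D%:R -> alg_clustering_form Q omega form q) /\
  (forall alpha : R, 0 < alpha -> exp_clustering_state Q omega alpha ->
     exists form : O -> O -> R[i], is_GNS_sum_form Q omega form /\
       forall beta : R, 0 < beta -> beta < alpha / 2 -> exp_clustering_form Q omega form beta).
Proof.
split=> [p _ [Dp st]|alpha a0 st].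
  have D0 := ler0n R D.
  (* The shift by one keeps [h] positive and nonincreasing down to distance 0. *)
  pose h d : R := powR d.+1%:R (- p).
  have h0 d : 0 < h d by rewrite powR_gt0.
  have [nu nu0 hcov] : exists2 nu : nat -> R, forall l, 0 <= nu l &
    forall l A B X Y k, loc Q X A -> loc Q Y B ->
      (#|` X| < l)%N -> (#|` Y| < l)%N -> separated X Y k ->
      normc (cov omega A B) <= nu l * (onorm Q A * onorm Q B * h k).
    apply: (clustering_state_cov st h0) => [|d d0].
      by apply: powR_succ_noninc; lra.
    by apply: (@powR_scale_le _ p) => //; [lra|lia].
  have [Sh hS] := powR_lattice_summable Dp.
  have inv : transl_inv_state Q omega by case: st.
  have hge0 d : 0 <= h d by exact: ltW.
  have [form hform] := GNS_sum_exists inv nu0 hge0 hcov hS.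
  exists form; split=> // q Dq qp.
  (* The exponent [p] is split into [q], kept as decay of the form, and [p - q > D], spent on
     summability. *)
  have [Ss sS] : lattice_summable D (fun d => powR d.+1%:R (- (p - q)) : R).
    by apply: powR_lattice_summable; lra.
  apply: (form_clustering inv nu0 hge0 hcov hS hform
    (s := fun d => powR d.+1%:R (- (p - q))) (t := fun d => powR d.+1%:R (- q))
    (Kg := powR 2 q) _ _ _ sS) => //.
  - by move=> d; rewrite powR_ge0.
  - by move=> d; rewrite powR_ge0.
  - apply: decay_interpolation => [d|d|d||]; rewrite ?powR_ge0//.
    + by rewrite -powRD ?pnatr_eq0 ?implybT// /h; congr powR; lra.
    + by apply: powR_succ_noninc; lra.
    + by apply: powR_succ_noninc; lra.
  - by move=> n n0; rewrite powR_gt0 ?ltr0n.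
  - move=> n n0; apply: powR_scale_le => //; first by lra.
    by rewrite uphalf_half; have := odd_double_half n; lia.
  - by rewrite powR_ge0.
pose h d : R := expR (- (alpha * d%:R)).
have h0 d : 0 < h d by rewrite expR_gt0.
have [nu nu0 hcov] : exists2 nu : nat -> R, forall l, 0 <= nu l &
  forall l A B X Y k, loc Q X A -> loc Q Y B ->
    (#|` X| < l)%N -> (#|` Y| < l)%N -> separated X Y k ->
    normc (cov omega A B) <= nu l * (onorm Q A * onorm Q B * h k).
  apply: (clustering_state_cov (K := 1) st h0) => [|d d0].
    by apply: expR_noninc; lra.
  by rewrite mul1r.
have [Sh hS] := expR_lattice_summable D a0.
have inv : transl_inv_state Q omega by case: st.
have hge0 d : 0 <= h d by exact: ltW.
have [form hform] := GNS_sum_exists inv nu0 hge0 hcov hS.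
exists form; split=> // beta b0 ba.
(* The rate [2 * beta] goes to [t] because its argument is about [n / 2]; the positive remainder
   makes [s] summable. *)
have ab : 0 < alpha - 2 * beta by lra.
have [Ss sS] := expR_lattice_summable D ab.
apply: (form_clustering inv nu0 hge0 hcov hS hform
  (s := fun d => expR (- ((alpha - 2 * beta) * d%:R)))
  (t := fun d => expR (- (2 * beta * d%:R))) (Kg := 1) _ _ _ sS) => //.
- by move=> d; rewrite expR_ge0.
- by move=> d; rewrite expR_ge0.
- apply: decay_interpolation => [d|d|d||]; rewrite ?expR_ge0//.
  + by rewrite -expRD /h; congr expR; ring.
  + by apply: expR_noninc; lra.
  + by apply: expR_noninc; lra.
- by move=> n n0; rewrite expR_gt0.
- move=> n n0; rewrite mul1r ler_expR lerN2 [2 * _]mulrC -mulrA ler_pM2l// -natrM ler_nat.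
  by rewrite uphalf_half; have := odd_double_half n; lia.
Qed.
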